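(* Let $B>0$ and let $V$ be a piecewise continuous real-valued potential on $(-\infty,B]$ supported in $[0,B]$ and satisfying the following bump condition: there exists $A\in(0,B]$ such that $V(x)>0$ for all $x\in(0,A]$. Fix two constants $0<c_k<C_k<\infty$. Then there exist constants $C>0$, $\delta>0$, $h_0>0$ such that for all $0<h<h_0$ and any $k\in[c_k,C_k]$: 1. If $k$ is a Neumann eigenvalue, then there exist a bound state $k_+$ and an antibound state $k_-$ such that $|k-k_+|\le Ce^{-\delta/h}$ and $|k-k_-|\le Ce^{-\delta/h}$. 2. If $k$ is a bound state or an antibound state, then there exists a Neumann eigenvalue $k_0$ such that $|k-k_0|\le Ce^{-\delta/h}$. (Bound states, antibound states and Neumann eigenvalues are those of $P(h)=-h^2\partial_x^2+V(x)$ for the given value of $h$, as defined in the context.)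
   Context: For $h>0$, let $P(h)=-h^2\partial_x^2+V(x)$ on the half-line $(-\infty,B]$ with the Neumann boundary condition $u_x(B)=0$. It is self-adjoint on $L^2(-\infty,B)$, and its resolvent $R_V(\lambda)=(P(h)-\lambda^2)^{-1}$, $\operatorname{Im}\lambda>0$, extends meromorphically to $\lambda\in\mathbb{C}$ as an operator $L^2_{\mathrm{comp}}\to H^2_{\mathrm{loc}}$. The poles are called resonances; $\lambda$ is a resonance when there is a nonzero $u\in H^2_{\mathrm{loc}}(-\infty,B)$ with $(P(h)-\lambda^2)u=0$, $u_x(B)=0$, and $u(x)=\alpha e^{-i\lambda x/h}$ for all $x<0$ and some constant $\alpha$. A positive number $k$ is a bound state if $ik$ is a pole of $R_V$, and an antibound state if $-ik$ is a pole of $R_V$. Equivalently, $k>0$ is a bound state (respectively, an antibound state) if and only if there is a nonzero solution $u\in H^2(0,B)$ of $(P(h)+k^2)u=0$ on $[0,B]$ with $u_x(B)=0$ and $hu_x(0)-ku(0)=0$ (respectively, $hu_x(0)+ku(0)=0$). A number $k>0$ is called a Neumann eigenvalue if there is a nonzero solution $u\in H^2(0,B)$ of $(P(h)+k^2)u=0$ on $[0,B]$ with $u_x(B)=0$ and $u_x(0)=0$. *)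

(* Defs.v *)
From HB Require Import structures.
From mathcomp Require Export all_boot all_order all_algebra.
From mathcomp Require Export complex.
From mathcomp Require Export all_classical all_reals all_analysis.
Import Order.TTheory GRing.Theory Num.Theory.
Export numFieldNormedType.Exports.

Set Implicit Arguments.
Unset Strict Implicit.
Unset Printing Implicit Defensive.

Local Open Scope classical_set_scope.
Local Open Scope ring_scope.
Local Open Scope complex_scope.

(* Complex-valued functions on the line are R -> R[i]; the library integrates
   real functions only, so integrability and integrals are taken on real and
   imaginary parts.  [complex.Re] and [complex.Im] are the R-valued parts. *)

Definition cexp (R : realType) (z : R[i]) : R[i] :=
  (expR (complex.Re z) * cos (complex.Im z)) +i*
  (expR (complex.Re z) * sin (complex.Im z)).

Definition L1_on (R : realType) (a b : R) (f : R -> R[i]) : Prop :=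
  (@lebesgue_measure R).-integrable `[a, b]
    (fun x => (complex.Re (f x))%:E) /\
  (@lebesgue_measure R).-integrable `[a, b]
    (fun x => (complex.Im (f x))%:E).

Definition L2_on (R : realType) (a b : R) (f : R -> R[i]) : Prop :=
  [/\ measurable_fun `[a, b] (fun x => complex.Re (f x)),
      measurable_fun `[a, b] (fun x => complex.Im (f x)) &
      (@lebesgue_measure R).-integrable `[a, b]
        (fun x => ((complex.Re (f x)) ^+ 2 + (complex.Im (f x)) ^+ 2)%:E)].

Definition cintegral (R : realType) (a b : R) (f : R -> R[i]) : R[i] :=
  Rintegral (@lebesgue_measure R) `[a, b] (fun x => complex.Re (f x)) +i*
  Rintegral (@lebesgue_measure R) `[a, b] (fun x => complex.Im (f x)).

(* f is absolutely continuous on [a, b] with derivative g almost everywhere. *)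
Definition AC_with_derivative (R : realType) (a b : R) (f g : R -> R[i]) :
    Prop :=
  L1_on a b g /\ (forall x, a <= x <= b -> f x = f a + cintegral a x g).

(* u belongs to H^2(a, b), with derivatives u1 and u2.  On a bounded interval,
   H^2(a, b) consists of the C^1 functions on [a, b] whose derivative is
   absolutely continuous with derivative in L^2; u is the continuous
   representative of its class.  As u1 is itself continuous, it is the classical
   derivative of u on [a, b] (one-sided at the endpoints), so that u1 a and u1 b
   are the boundary values of u_x; u2 is determined almost everywhere. *)
Definition H2_on (R : realType) (a b : R) (u u1 u2 : R -> R[i]) : Prop :=
  [/\ AC_with_derivative a b u u1,
      AC_with_derivative a b u1 u2 &
      L2_on a b u2].

(* H^2_loc of the half-line (-oo, B]: H^2 up to the endpoint B. *)
Definition H2loc_halfline (R : realType) (B : R) (u u1 u2 : R -> R[i]) :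
    Prop :=
  forall a, a < B -> H2_on a B u u1 u2.

(* (P(h) - E) u = 0 almost everywhere on D, where P(h) = - h^2 d^2/dx^2 + V and
   u2 stands for the second derivative of u. *)
Definition schrodinger_eq (R : realType) (V : R -> R) (h : R) (E : R[i])
    (D : set R) (u u2 : R -> R[i]) : Prop :=
  {ae (@lebesgue_measure R), forall x, D x ->
     - (h ^+ 2)%:C * u2 x + (V x)%:C * u x - E * u x = 0}.

Definition is_resonance (R : realType) (V : R -> R) (B h : R) (lam : R[i]) :
    Prop :=
  exists u u1 u2 : R -> R[i],
    [/\ H2loc_halfline B u u1 u2,
        exists2 x, x <= B & u x != 0,
        schrodinger_eq V h (lam ^+ 2) `]-oo, B] u u2,
        u1 B = 0 &
        exists alpha : R[i], forall x, x < 0 ->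
          u x = alpha * cexp (- 'i%C * lam * x%:C / h%:C)].

Definition bound_state (R : realType) (V : R -> R) (B h k : R) : Prop :=
  0 < k /\ is_resonance V B h ('i%C * k%:C).

Definition antibound_state (R : realType) (V : R -> R) (B h k : R) : Prop :=
  0 < k /\ is_resonance V B h (- ('i%C * k%:C)).

Definition neumann_eigenvalue (R : realType) (V : R -> R) (B h k : R) : Prop :=
  0 < k /\
  exists u u1 u2 : R -> R[i],
    [/\ H2_on 0 B u u1 u2,
        exists2 x, 0 <= x <= B & u x != 0,
        schrodinger_eq V h (- (k ^+ 2)%:C) `[0, B] u u2,
        u1 B = 0 &
        u1 0 = 0].

(* Finitely many exceptional points on each bounded interval [a, B], and finite
   one-sided limits everywhere, from the left only at the endpoint B.  The values
   of V on ]B, +oo[ are irrelevant, as is its value at a jump. *)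
Definition piecewise_continuous (R : realType) (B : R) (V : R -> R) : Prop :=
  [/\ forall a, a < B ->
        finite_set [set x | a <= x < B /\ ~ {for x, continuous V}],
      forall x, x <= B -> cvg (V y @[y --> x^'-]) &
      forall x, x < B -> cvg (V y @[y --> x^'+])].

(* Main.v *)
(* For each k let phi(., k) solve h^2 phi'' = (V + k^2) phi with phi(B) = 1 and
   phi'(B) = 0, and put a(k) = phi(0, k), b(k) = h phi'(0, k).  Up to a factor,
   phi is the only solution satisfying the boundary condition at B, so k is a
   bound state, a Neumann eigenvalue or an antibound state if and only if
   b = k a, b = 0 or b = - k a respectively.  The Wronskian identity gives
   a b' - a' b = - (2k/h) int_0^B phi^2, so the slope b/a decreases with k.  If
   |b| <= (k + eta) |a|, where eta is exponentially small, then positivity of V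
   near 0 forces phi to grow exponentially on [0, A] (even from the slope - k,
   where the free solution would decay), so that int_0^B phi^2 is exponentially
   larger than a^2.  Hence b/a runs through the whole range [-k, k] within an
   exponentially small interval of k, and meets k, 0 and - k there.  Everything
   is done with classical derivatives away from the jumps of V. *)

Require Import Defs.
From mathcomp Require Import ring lra measurable_realfun.
Import Order.TTheory GRing.Theory Num.Theory.
Local Open Scope classical_set_scope.
Local Open Scope ring_scope.

Set Implicit Arguments.
Unset Strict Implicit.
Unset Printing Implicit Defensive.

(** Two obstacles shape the argument: b/a has poles at the zeros of a, and the bound Q >= M a^2 for
    the Wronskian quantity Q = a' b - a b' is available only in the cone |b| <= (k + eta) |a|. So
    b/a is not followed directly. If b - th k a kept its sign over a window of length e, the inverse
    distance a / (b - th k a) to the target slope th k would satisfy a Riccati inequality and blow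
    up inside the window, while b/a stays in the cone. The target moves with k, which costs only one
    unit of M because th >= -1. Differentiability of phi in k is never established: the Wronskian
    identity for two distinct parameters is exact, and Lipschitz dependence on k makes its
    right-hand side continuous, which yields the derivative of the ratio. Three scales are used: M ~
    e^(sigma/h), e ~ e^(-sigma/(2h)) and eta ~ e^(-sigma/(4h)). The product M e is large enough for
    the slope to fall by k, and e is negligible against eta, so the cone condition tolerates moving
    k inside the window. *)

(** * Calculus of continuous functions differentiable off a finite set *)

Section PiecewiseDerivative.
Variable R : realType.
Implicit Types (S : seq R) (a b x y : R) (f g df dg : R -> R).

(* The finitely many exceptional points [S] are the jumps of the potential. *)
Definition pw_deriv S a b f df :=
  {within `[a, b], continuous f} /\
  forall x, a < x < b -> x \notin S -> is_derive x 1 f (df x).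

Lemma pw_deriv_sub S a b a' b' f df : a <= a' -> b' <= b ->
  pw_deriv S a b f df -> pw_deriv S a' b' f df.
Proof.
move=> aa bb [cf f'f]; split.
  apply: continuous_subspaceW cf => x /=; rewrite !in_itv /= => /andP[h1 h2].
  by rewrite (le_trans aa h1) (le_trans h2 bb).
move=> x /andP[h1 h2]; apply: f'f.
by rewrite (le_lt_trans aa h1) (lt_le_trans h2 bb).
Qed.

Lemma pw_deriv_eq S a b f df dg :
  (forall x, a < x < b -> x \notin S -> df x = dg x) ->
  pw_deriv S a b f df -> pw_deriv S a b f dg.
Proof.
by move=> e [cf f'f]; split=> // x xab xS; rewrite -e//; exact: f'f.
Qed.

Lemma pw_deriv_ext S a b f g df : (forall x, a <= x <= b -> f x = g x) ->
  pw_deriv S a b f df -> pw_deriv S a b g df.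
Proof.
move=> fg [cf f'f]; split.
  apply: subspace_eq_continuous cf => x; rewrite inE /= in_itv /=; exact: fg.
move=> x /[dup] xab /andP[ax xb] xS; have := f'f x xab xS.
apply: near_eq_is_derive.
near=> y; apply: fg; rewrite !ltW//; near: y.
- exact: lt_nbhsl.
- exact: lt_nbhsr.
Unshelve. all: by end_near. Qed.

Lemma pw_derivT S a b f df :
  (forall x, is_derive x 1 f (df x)) -> pw_deriv S a b f df.
Proof.
move=> f'f; split=> [|x _ _]; last exact: f'f.
apply: continuous_subspaceT => x.
exact/differentiable_continuous/derivable1_diffP/(@ex_derive _ _ _ _ _ _ _ (f'f x)).
Qed.

Lemma pw_deriv_cst S a b c : pw_deriv S a b (cst c) (fun=> 0).
Proof. by apply: pw_derivT => x; exact: is_derive_cst. Qed.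

Lemma pw_deriv_id S a b : pw_deriv S a b id (fun=> 1).
Proof. by apply: pw_derivT => x; exact: is_derive_id. Qed.

Lemma pw_deriv_exp S a b c :
  pw_deriv S a b (fun x => expR (c * x)) (fun x => c * expR (c * x)).
Proof.
apply: pw_derivT => x.
have h : is_derive x 1 (fun x => c * x) c.
  have := @is_deriveZ R R R id c x 1 1 (is_derive_id x 1).
  by rewrite /GRing.scale /= mulr1.
have := @is_derive1_comp R expR (fun x => c * x) x _ _ (is_derive_expR (c * x)) h.
by rewrite mulrC.
Qed.

Lemma pw_derivD S a b f g df dg : pw_deriv S a b f df -> pw_deriv S a b g dg ->
  pw_deriv S a b (fun x => f x + g x) (fun x => df x + dg x).
Proof.
move=> [cf f'f] [cg g'g]; split=> [x|x xab xS].
  exact: continuousD (cf x) (cg x).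
by apply: is_deriveD; [exact: f'f|exact: g'g].
Qed.

Lemma pw_derivM S a b f g df dg : pw_deriv S a b f df -> pw_deriv S a b g dg ->
  pw_deriv S a b (fun x => f x * g x) (fun x => df x * g x + f x * dg x).
Proof.
move=> [cf f'f] [cg g'g]; split=> [x|x xab xS].
  exact: continuousM (cf x) (cg x).
apply: is_derive_eq; first by apply: is_deriveM; [exact: f'f|exact: g'g].
by rewrite /GRing.scale /= addrC mulrC.
Qed.

Lemma pw_derivZ S a b c f df : pw_deriv S a b f df ->
  pw_deriv S a b (fun x => c * f x) (fun x => c * df x).
Proof.
move=> hf; apply: pw_deriv_eq (pw_derivM (pw_deriv_cst S a b c) hf) => x _ _.
by rewrite mul0r add0r.
Qed.

Lemma pw_derivN S a b f df : pw_deriv S a b f df ->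
  pw_deriv S a b (fun x => - f x) (fun x => - df x).
Proof.
move=> [cf f'f]; split=> [x|x xab xS]; first exact: continuousN (cf x).
by apply: is_deriveN; exact: f'f.
Qed.

Lemma pw_derivB S a b f g df dg : pw_deriv S a b f df -> pw_deriv S a b g dg ->
  pw_deriv S a b (fun x => f x - g x) (fun x => df x - dg x).
Proof. by move=> hf hg; exact: pw_derivD hf (pw_derivN hg). Qed.

(** Continuity at an exceptional point lets the two adjacent intervals be joined, so induction on
    [S] reduces to the mean value theorem. The comparison lemmas below rest on this one. *)
Lemma pw_deriv_ndecr S a b f df : a <= b -> pw_deriv S a b f df ->
  (forall x, a < x < b -> x \notin S -> 0 <= df x) -> f a <= f b.
Proof.
elim: S a b => [|s S IH] a b ab [cf f'f] df0.
  (* The intermediate point may be an endpoint of [a, b], where the sign of [df] is unknown; the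
     value 0 there is harmless. *)
  have [x|c cab E] := MVT_segment ab _ cf (df := fun x => if a < x < b then df x else 0).
    by rewrite in_itv /= => /[dup] h ->; exact: f'f.
  rewrite -subr_ge0 E; apply: mulr_ge0; last by rewrite subr_ge0.
  by case: ifPn => // h; exact: df0.
have [/andP[as_ sb]|sab] := boolP (a < s < b).
  have := @pw_deriv_sub (s :: S) a b a s f df (lexx _) (ltW sb) (conj cf f'f).
  have := @pw_deriv_sub (s :: S) a b s b f df (ltW as_) (lexx _) (conj cf f'f).
  move=> [c2 d2] [c1 d1]; apply: (@le_trans _ _ (f s)); apply: IH (ltW _) _ _ => //.
  - split=> // x /[dup] xas /andP[ax xs] xS; apply: d1 => //.
    by rewrite inE negb_or xS (lt_eqF xs).
  - move=> x /andP[ax xs] xS; apply: df0; first by rewrite ax (lt_trans xs).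
    by rewrite inE negb_or xS (lt_eqF xs).
  - split=> // x /[dup] xas /andP[sx xb] xS; apply: d2 => //.
    by rewrite inE negb_or xS (gt_eqF sx).
  - move=> x /andP[sx xb] xS; apply: df0; first by rewrite xb (lt_trans as_).
    by rewrite inE negb_or xS (gt_eqF sx).
have xs x : a < x < b -> x \notin S -> x \notin s :: S.
  by move=> xab xS; rewrite inE negb_or xS andbT; apply: contra sab => /eqP <-.
apply: IH => //.
  by split=> // x xab xS; apply: f'f => //; exact: xs.
by move=> x xab xS; apply: df0 => //; exact: xs.
Qed.

Lemma pw_deriv_le S a b f g df dg : pw_deriv S a b f df -> pw_deriv S a b g dg ->
  (forall x, a < x < b -> x \notin S -> df x <= dg x) ->
  forall x y, a <= x -> x <= y -> y <= b -> f y - f x <= g y - g x.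
Proof.
move=> hf hg le x y ax xy yb.
have h := pw_deriv_sub ax yb (pw_derivB hg hf).
have := pw_deriv_ndecr xy h; rewrite /= => /(_ _) H.
suff: g x - f x <= g y - f y by lra.
apply: H => z /andP[xz zy] zS; rewrite subr_ge0; apply: le => //.
by rewrite (le_lt_trans ax xz) (lt_le_trans zy yb).
Qed.

Lemma pw_deriv_unique S a b f g df : pw_deriv S a b f df -> pw_deriv S a b g df ->
  forall x y, a <= x <= b -> a <= y <= b -> f y - f x = g y - g x.
Proof.
move=> hf hg x y; wlog xy : x y / x <= y.
  move=> H; have [|yx xab yab] := leP x y; first exact: H.
  have := H _ _ (ltW yx) yab xab; lra.
move=> /andP[ax xb] /andP[ay yb]; apply/eqP; rewrite eq_le.
by rewrite (pw_deriv_le hf hg)// (pw_deriv_le hg hf).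
Qed.

End PiecewiseDerivative.

(** * Integrals of bounded functions with finitely many discontinuities *)

Section PiecewisePrimitive.
Variable R : realType.
Implicit Types (S : seq R) (a b x y : R) (f g : R -> R).
Local Notation mu := (@lebesgue_measure R).

Definition pw_cont S a b g :=
  (exists M, forall x, a <= x <= b -> `|g x| <= M) /\
  forall x, a < x < b -> x \notin S -> {for x, continuous g}.

Lemma measurable_fun_pw_cont S a b g :
  (forall x, a < x < b -> x \notin S -> {for x, continuous g}) ->
  measurable_fun `[a, b] g.
Proof.
elim: S a b => [|s S IH] a b cg.
  apply: (@measurable_fun_itv_cc _ _ _ false true).
  apply: subspace_continuous_measurable_fun => //.
  rewrite continuous_open_subspace; last exact: interval_open.
  by move=> x; rewrite inE /= in_itv /= => xab; exact: cg.
have [/andP[as_ sb]|sab] := boolP (a < s < b).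
  have -> : `[a, b]%classic = `[a, s] `|` `[s, b].
    apply/seteqP; split=> x /=; rewrite !in_itv /=.
      by move=> /andP[-> ->]; case: (leP x s) => h; [left|right; rewrite ltW].
    case=> /andP[h1 h2]; first by rewrite h1 (le_trans h2 (ltW sb)).
    by rewrite h2 (le_trans (ltW as_) h1).
  apply/measurable_funU => //; split; apply: IH => x /andP[h1 h2] xS; apply: cg.
  - by rewrite h1 (lt_trans h2).
  - by rewrite inE negb_or xS (lt_eqF h2).
  - by rewrite h2 (lt_trans _ h1).
  - by rewrite inE negb_or xS (gt_eqF h1).
apply: IH => x xab xS; apply: cg => //.
by rewrite inE negb_or xS andbT; apply: contra sab => /eqP <-.
Qed.

Lemma bounded_integrable a b g M : measurable_fun `[a, b] g ->
  (forall x, a <= x <= b -> `|g x| <= M) -> mu.-integrable `[a, b] (EFin \o g).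
Proof.
move=> mg gM; apply: measurable_bounded_integrable => //.
  rewrite /= lebesgue_measure_itv /=.
  by case: ifPn => // _; rewrite -EFinB ltry.
exists M; split; first exact: num_real.
move=> N MN x /=; rewrite in_itv /= => xab.
exact: le_trans (gM x xab) (ltW MN).
Qed.

Lemma pw_cont_integrable S a b g : pw_cont S a b g ->
  mu.-integrable `[a, b] (EFin \o g).
Proof.
move=> [[M gM] cg]; apply: bounded_integrable gM.
exact: measurable_fun_pw_cont cg.
Qed.

Lemma pw_deriv_integral S a b g : a <= b ->
  mu.-integrable `[a, b] (EFin \o g) ->
  (forall x, a < x < b -> x \notin S -> {for x, continuous g}) ->
  pw_deriv S a b (fun x => Rintegral mu `[a, x] g) g.
Proof.
move=> ab ig cg; split; first exact: parameterized_integral_continuous ab ig.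
move=> x /[dup] xab /andP[ax xb] xS.
have [d e] := continuous_FTC1_closed xb ig ax (cg x xab xS).
by apply: DeriveDef; [exact: d|rewrite -derive1E; exact: e].
Qed.

Lemma pw_primitive S a b g : a <= b -> pw_cont S a b g ->
  exists2 F, F a = 0 & pw_deriv S a b F g.
Proof.
move=> ab hg; exists (fun x => Rintegral mu `[a, x] g).
  by rewrite set_itv1 Rintegral_set1.
by apply: pw_deriv_integral => //; [exact: pw_cont_integrable hg|case: hg].
Qed.

Lemma pw_deriv_integralE S a b f df : a <= b -> pw_cont S a b df ->
  pw_deriv S a b f df ->
  forall x, a <= x <= b -> f x = f a + Rintegral mu `[a, x] df.
Proof.
move=> ab cdf f'f x xab.
have h := pw_deriv_integral ab (pw_cont_integrable cdf) (proj2 cdf).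
have aab : a <= a <= b by rewrite lexx.
have := pw_deriv_unique f'f h aab xab; rewrite /= set_itv1 Rintegral_set1; lra.
Qed.

Lemma within_continuous_bounded a b f : a <= b ->
  {within `[a, b], continuous f} ->
  exists2 M, 0 <= M & forall x, a <= x <= b -> `|f x| <= M.
Proof.
move=> ab cf; have cnf : {within `[a, b], continuous (fun x => `|f x|)}.
  by move=> x; apply: continuous_comp (cf x) _; exact: norm_continuous.
have [c cab cM] := EVT_max ab cnf; exists `|f c|; first by [].
by move=> x xab; apply: cM; rewrite in_itv.
Qed.

Lemma within_continuous_at a b f x : {within `[a, b], continuous f} ->
  a < x < b -> {for x, continuous f}.
Proof.
move=> cf xab; have : {within `]a, b[, continuous f}.
  apply: continuous_subspaceW cf => y /=; rewrite !in_itv /= => /andP[? ?].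
  by rewrite !ltW.
rewrite continuous_open_subspace; last exact: interval_open.
by apply; rewrite inE /= in_itv.
Qed.

Lemma pw_cont_within S a b f : a <= b -> {within `[a, b], continuous f} ->
  pw_cont S a b f.
Proof.
move=> ab cf; split; last by move=> x xab _; exact: within_continuous_at cf xab.
by have [M _ h] := within_continuous_bounded ab cf; exists M.
Qed.

Lemma pw_contM S a b f g : pw_cont S a b f -> pw_cont S a b g ->
  pw_cont S a b (fun x => f x * g x).
Proof.
move=> [[M fM] cf] [[N gN] cg]; split.
  by exists (M * N) => x xab; rewrite normrM ler_pM ?fM ?gN.
by move=> x xab xS; apply: continuousM; [exact: cf|exact: cg].
Qed.

End PiecewisePrimitive.

(** * The equation u'' = W u: Wronskian, linearity, energy estimate *)

Section LinearODE.
Variable R : realType.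
Implicit Types (S : seq R) (a b x y : R) (f g W u v : R -> R).

Definition ode_sol S a b W u v :=
  pw_deriv S a b u v /\ pw_deriv S a b v (fun x => W x * u x).

Lemma wronskian_deriv S a b W1 W2 u1 v1 u2 v2 :
  ode_sol S a b W1 u1 v1 -> ode_sol S a b W2 u2 v2 ->
  pw_deriv S a b (fun x => u1 x * v2 x - v1 x * u2 x)
    (fun x => (W2 x - W1 x) * (u1 x * u2 x)).
Proof.
move=> [hu1 hv1] [hu2 hv2].
apply: pw_deriv_eq (pw_derivB (pw_derivM hu1 hv2) (pw_derivM hv1 hu2)) => x _ _.
ring.
Qed.

Lemma ode_sol_comb S a b W c1 c2 u1 v1 u2 v2 :
  ode_sol S a b W u1 v1 -> ode_sol S a b W u2 v2 ->
  ode_sol S a b W (fun x => c1 * u1 x + c2 * u2 x)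
    (fun x => c1 * v1 x + c2 * v2 x).
Proof.
move=> [hu1 hv1] [hu2 hv2].
split; first exact: pw_derivD (pw_derivZ c1 hu1) (pw_derivZ c2 hu2).
apply: pw_deriv_eq (pw_derivD (pw_derivZ c1 hv1) (pw_derivZ c2 hv2)) => x _ _.
ring.
Qed.

(** The energy N = u^2 + v^2 satisfies N' + L N >= - X^2, and N e^(L x) is integrated backwards from
    b, where the data vanish. The case X = 0 gives uniqueness, and X proportional to a change of
    parameter gives Lipschitz dependence. *)
Lemma ode_gronwall S a b W g u v w X : a <= b -> 0 <= w ->
  (forall x, a < x < b -> `|W x| <= w) ->
  (forall x, a < x < b -> `|g x| <= X) ->
  pw_deriv S a b u v -> pw_deriv S a b v (fun x => W x * u x + g x) ->
  u b = 0 -> v b = 0 ->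
  forall x, a <= x <= b -> u x ^+ 2 + v x ^+ 2 <=
    X ^+ 2 * ((b - a) * expR ((2 + w) * (b - a))).
Proof.
move=> ab w0 Ww gX hu hv ub vb x xab.
have /andP[ax xb] := xab.
set L := 2 + w.
pose N y := u y * u y + v y * v y.
have hN : pw_deriv S a b (fun y => N y * expR (L * y)) _ :=
  pw_derivM (pw_derivD (pw_derivM hu hu) (pw_derivM hv hv)) (pw_deriv_exp S a b L).
have hX : pw_deriv S a b (fun y => - (X ^+ 2 * expR (L * b)) * y) _ :=
  pw_derivZ (- (X ^+ 2 * expR (L * b))) (pw_deriv_id S a b).
have := pw_deriv_le hX hN _ ax xb (lexx b) => /(_ _) H.
have {H} : - (X ^+ 2 * expR (L * b)) * b - - (X ^+ 2 * expR (L * b)) * x <=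
    N b * expR (L * b) - N x * expR (L * x).
  apply: H => y /[dup] yab /andP[ay yb] _.
  have E1 : expR (L * y) <= expR (L * b).
    by rewrite ler_expR ler_pM2l ?ltW// /L; lra.
  have E0 := expR_gt0 (L * y).
  have X2 : 0 <= X ^+ 2 by exact: sqr_ge0.
  have gX2 : g y ^+ 2 <= X ^+ 2.
    by rewrite -(real_normK (num_real (g y))) ler_pXn2r ?nnegrE ?gX// (le_trans _ (gX y yab)).
  have := Ww y yab; rewrite ler_norml => /andP[W1 W2].
  have key : - X ^+ 2 <= u y * v y + u y * v y +
     ((W y * u y + g y) * v y + v y * (W y * u y + g y)) + L * N y.
    rewrite /L /N.
    (* In this form every term except - g^2 is nonnegative as soon as |W| <= w. *)
    have -> : u y * v y + u y * v y +
     ((W y * u y + g y) * v y + v y * (W y * u y + g y)) + (2 + w) * (u y * u y + v y * v y)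
     = (u y + v y) ^+ 2 + (g y + v y) ^+ 2 + u y ^+ 2 +
       ((w + W y) * (u y + v y) ^+ 2 + (w - W y) * (u y - v y) ^+ 2) / 2 - g y ^+ 2 by field.
    have s1 := sqr_ge0 (u y + v y); have s2 := sqr_ge0 (g y + v y).
    have s3 := sqr_ge0 (u y); have s4 := sqr_ge0 (u y - v y).
    have p1 : 0 <= (w + W y) * (u y + v y) ^+ 2 by apply: mulr_ge0 => //; lra.
    have p2 : 0 <= (w - W y) * (u y - v y) ^+ 2 by apply: mulr_ge0 => //; lra.
    lra.
  apply: (@le_trans _ _ (- X ^+ 2 * expR (L * y))).
    rewrite mulr1 mulNr lerN2 ler_wpM2l//.
  have -> : forall A B, A * expR (L * y) + B * (L * expR (L * y)) = (A + L * B) * expR (L * y).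
    by move=> A B; ring.
  rewrite ler_pM2r//; apply: le_trans key _; rewrite -/(N y).
  by rewrite [v y * u y]mulrC.
rewrite {1}/N ub vb !mulr0 addr0 mul0r sub0r => H.
have Ex := expR_gt0 (L * x).
rewrite -(ler_pM2r Ex); apply: (@le_trans _ _ (X ^+ 2 * expR (L * b) * (b - x))).
  by rewrite !expr2 -/(N x); lra.
have -> : X ^+ 2 * ((b - a) * expR (L * (b - a))) * expR (L * x) =
  X ^+ 2 * (expR (L * (b - a) + L * x) * (b - a)) by rewrite expRD; ring.
rewrite -mulrA; apply: ler_wpM2l; first exact: sqr_ge0.
apply: ler_pM; rewrite ?expR_ge0 ?subr_ge0//; last lra.
rewrite ler_expR; have -> : L * b = L * (b - x) + L * x by ring.
by rewrite lerD2r ler_pM2l ?/L; lra.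
Qed.

End LinearODE.

(** * Existence of solutions by Picard iteration *)

Section Picard.
Variable R : realType.
Implicit Types (S : seq R) (a b x y : R) (f g W u v : R -> R).
Local Notation mu := (@lebesgue_measure R).

Lemma approx_within_continuous (A : set R) f :
  (forall e, 0 < e -> exists2 g, {within A, continuous g} &
    forall x, A x -> `|f x - g x| <= e) ->
  {within A, continuous f}.
Proof.
move=> H; apply/subspace_continuousP => x Ax; apply/cvgrPdist_le => e e0.
have [g cg fg] := H (e / 3) ltac:(lra).
move/subspace_continuousP: cg => /(_ x Ax)/cvgrPdist_le/(_ (e / 3) ltac:(lra)) cg.
near=> y; have Ay : A y by near: y; exact: withinT.
have h1 := fg x Ax; have h2 := fg y Ay.
have h3 : `|g x - g y| <= e / 3 by near: y.
change (`|f x - f y| <= e : bool).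
move: h1 h2 h3; rewrite !ler_norml => /andP[h1 h1'] /andP[h2 h2'] /andP[h3 h3'].
apply/andP; split; lra.
Unshelve. all: by end_near. Qed.

(** The intervals s n -+ 2 C / 2^n are nested, since 2 C / 2^n is the sum of the remaining
    increments; the limit is the supremum of their lower ends. *)
Lemma geometric_limit (s : nat -> R) (C : R) :
  (forall n, `|s n.+1 - s n| <= C / 2 ^+ n) ->
  exists l, forall n, `|l - s n| <= 2 * C / 2 ^+ n.
Proof.
move=> H.
have p2 n : (0 : R) < 2 ^+ n by exact: exprn_gt0.
have C0 : 0 <= C by have := H 0%N; rewrite expr0 divr1; exact: le_trans.
have E n : C / 2 ^+ n = 2 * C / 2 ^+ n.+1.
  by rewrite exprS; field; rewrite gt_eqF.
have lo n m : (n <= m)%N -> s n - 2 * C / 2 ^+ n <= s m - 2 * C / 2 ^+ m.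
  move=> /subnK <-; elim: (m - n)%N => [|k IH]; first by rewrite add0n.
  apply: (le_trans IH); rewrite addSn.
  have := H (k + n)%N; rewrite ler_norml => /andP[].
  have := E (k + n)%N; have -> : 2 * C / 2 ^+ (k + n) = 2 * (C / 2 ^+ (k + n)) by rewrite mulrA.
  lra.
have up n m : (n <= m)%N -> s m + 2 * C / 2 ^+ m <= s n + 2 * C / 2 ^+ n.
  move=> /subnK <-; elim: (m - n)%N => [|k IH]; first by rewrite add0n.
  apply: (le_trans _ IH); rewrite addSn.
  have := H (k + n)%N; rewrite ler_norml => /andP[].
  have := E (k + n)%N; have -> : 2 * C / 2 ^+ (k + n) = 2 * (C / 2 ^+ (k + n)) by rewrite mulrA.
  lra.
have pos n : 0 <= 2 * C / 2 ^+ n by apply: divr_ge0; [exact: mulr_ge0|exact: ltW].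
pose A : set R := [set s n - 2 * C / 2 ^+ n | n in [set: nat]].
have Aub n : ubound A (s n + 2 * C / 2 ^+ n).
  move=> _ [m _ <-]; case: (leqP n m) => nm.
    have := up _ _ nm; have := pos m; lra.
  have := lo _ _ (ltnW nm); have := pos n; lra.
exists (sup A) => n; rewrite ler_norml; apply/andP; split.
  rewrite -subr_ge0 opprK; have : s n - 2 * C / 2 ^+ n <= sup A.
    by apply: ub_le_sup; [exists (s n + 2 * C / 2 ^+ n)|exists n].
  lra.
have : sup A <= s n + 2 * C / 2 ^+ n by apply: ge_sup => //; exists (s 0%N - 2 * C / 2 ^+ 0); exists 0%N.
lra.
Qed.

Lemma half_exp_small (c e : R) : 0 < e -> exists n : nat, c / 2 ^+ n <= e.
Proof.
move=> e0; have [n hn] : exists n : nat, `|c| / e < n%:R.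
  by exists (Num.Def.archi_bound (`|c| / e)); apply: archi_boundP; rewrite divr_ge0// ltW.
exists n; have p2 : (0 : R) < 2 ^+ n by exact: exprn_gt0.
rewrite ler_pdivrMr//; apply: (le_trans (ler_norm c)).
move: hn; rewrite ltr_pdivrMr// => /ltW hn; apply: (le_trans hn).
rewrite mulrC ler_pM2l// -natrX ler_nat; exact: ltnW (ltn_expl _ _).
Qed.

(** In the norm weighted by e^(L x), each integration gains a factor 1/L. *)
Lemma pw_deriv_exp_bound S a b L c f df : 0 < L -> 0 <= c -> pw_deriv S a b f df ->
  f a = 0 ->
  (forall x, a < x < b -> `|df x| <= c * expR (L * x)) ->
  forall x, a <= x <= b -> `|f x| <= c / L * expR (L * x).
Proof.
move=> L0 c0 hf fa df_le x /andP[ax xb].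
have hE := pw_derivZ (c / L) (pw_deriv_exp S a b L).
have E y : c / L * (L * expR (L * y)) = c * expR (L * y).
  by field; rewrite gt_eqF.
have h1 : f x - f a <= c / L * expR (L * x) - c / L * expR (L * a).
  apply: (pw_deriv_le hf hE) => // y /df_le + _.
  by rewrite E ler_norml => /andP[].
have h2 : - f x - - f a <= c / L * expR (L * x) - c / L * expR (L * a).
  apply: (pw_deriv_le (pw_derivN hf) hE) => // y /df_le + _.
  by rewrite E ler_norml => /andP[h _]; rewrite lerNl.
have : 0 <= c / L * expR (L * a) by rewrite mulr_ge0 ?expR_ge0 ?divr_ge0// ltW.
rewrite ler_norml; move: h1 h2; rewrite fa; lra.
Qed.

(** The weight e^(L x) makes the integral operator [T] a contraction on the whole of [a, b], so that
    no subdivision into short intervals is needed. *)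
Lemma ode_exists S a b W (u0 v0 : R) : a <= b -> pw_cont S a b W ->
  exists u v, [/\ ode_sol S a b W u v, u a = u0 & v a = v0].
Proof.
move=> ab hW; have [[w0 Ww0] cW] := hW.
pose w := `|w0|; have w_ge0 : 0 <= w by exact: normr_ge0.
have Ww x : a <= x <= b -> `|W x| <= w.
  by move=> /Ww0 h; exact: le_trans h (ler_norm _).
(* Two integrations cost w / L^2, and this value of L makes that at most 1/2. *)
pose L := 2 * w + 1; have L0 : 0 < L by rewrite /L; lra.
pose P g x := Rintegral mu `[a, x] g.
have P_a g : P g a = 0 by rewrite /P set_itv1 Rintegral_set1.
have hP g : pw_cont S a b g -> pw_deriv S a b (P g) g.
  move=> hg; apply: pw_deriv_integral => //; last exact: proj2 hg.
  exact: pw_cont_integrable hg.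
pose V f x := v0 + P (fun y => W y * f y) x.
pose T f x := u0 + P (V f) x.
have hV f : {within `[a, b], continuous f} -> pw_deriv S a b (V f) (fun x => W x * f x).
  move=> cf; apply: pw_deriv_eq; last first.
    exact: pw_derivD (pw_deriv_cst _ _ _ v0) (hP _ (pw_contM hW (pw_cont_within S ab cf))).
  by move=> x _ _; rewrite /= add0r.
have hT f : {within `[a, b], continuous f} -> pw_deriv S a b (T f) (V f).
  move=> cf; apply: pw_deriv_eq; last first.
    exact: pw_derivD (pw_deriv_cst _ _ _ u0) (hP _ (pw_cont_within S ab (proj1 (hV _ cf)))).
  by move=> x _ _; rewrite /= add0r.
have contr f g c : {within `[a, b], continuous f} -> {within `[a, b], continuous g} ->
    0 <= c -> (forall x, a <= x <= b -> `|f x - g x| <= c * expR (L * x)) ->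
    forall x, a <= x <= b -> `|T f x - T g x| <= c / 2 * expR (L * x).
  move=> cf cg c0 fg.
  have bV : forall x, a <= x <= b -> `|V f x - V g x| <= w * c / L * expR (L * x).
    apply: pw_deriv_exp_bound (pw_derivB (hV _ cf) (hV _ cg)) _ _ => //.
    - exact: mulr_ge0.
    - by rewrite /V !P_a subrr.
    - move=> x /andP[ax xb]; rewrite -mulrBr normrM -mulrA.
      by apply: ler_pM => //; [apply: Ww|apply: fg]; rewrite !ltW.
  have bT : forall x, a <= x <= b -> `|T f x - T g x| <= w * c / L / L * expR (L * x).
    apply: pw_deriv_exp_bound (pw_derivB (hT _ cf) (hT _ cg)) _ _ => //.
    - by rewrite !mulr_ge0// invr_ge0 ltW.
    - by rewrite /T !P_a subrr.
    - by move=> x /andP[ax xb]; apply: bV; rewrite !ltW.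
  move=> x xab; apply: (le_trans (bT x xab)); rewrite ler_pM2r ?expR_gt0//.
  rewrite ler_pdivrMr// ler_pdivrMr//.
  have -> : c / 2 * L * L = c * (L * L / 2) by field.
  by rewrite mulrC; apply: ler_wpM2l => //; rewrite /L; nra.
have cc : {within `[a, b], continuous (cst u0)} by exact: (proj1 (pw_deriv_cst S a b u0)).
pose U n := iter n T (cst u0).
have cU n : {within `[a, b], continuous (U n)}.
  by elim: n => [//|n IH]; exact: (proj1 (hT _ IH)).
have [M0 M0_ge0 hM0] : exists2 M, 0 <= M & forall x, a <= x <= b -> `|U 1%N x - U 0%N x| <= M * expR (L * x).
  have [M M_ge0 hM] := within_continuous_bounded ab (proj1 (pw_derivB (hT _ (cU 0%N)) (pw_deriv_cst S a b u0))).
  exists (M / expR (L * a)); first by rewrite divr_ge0// expR_ge0.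
  move=> x /[dup] /andP[ax xb] /hM h; apply: (le_trans h).
  rewrite -mulrA -[X in X <= _]mulr1; apply: ler_wpM2l => //.
  by rewrite mulrC ler_pdivlMr ?expR_gt0// mul1r ler_expR ler_pM2l.
have dU n x : a <= x <= b -> `|U n.+1 x - U n x| <= M0 * expR (L * x) / 2 ^+ n.
  elim: n x => [|n IH] x xab; first by rewrite expr0 divr1 hM0.
  have := contr _ _ (M0 / 2 ^+ n) (cU n.+1) (cU n) _ _ x xab.
  have -> : M0 / 2 ^+ n / 2 * expR (L * x) = M0 * expR (L * x) / 2 ^+ n.+1.
    by rewrite exprSr; field; rewrite expf_neq0.
  apply; first by rewrite divr_ge0// exprn_ge0.
  by move=> y yab; rewrite mulrAC; exact: IH.
have /choice[u hu] : forall x, exists l, a <= x <= b -> forall n, `|l - U n x| <= 2 * (M0 * expR (L * x)) / 2 ^+ n.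
  move=> x; have [xab|nxab] := boolP (a <= x <= b); last by exists 0.
  have [l hl] := geometric_limit (fun n => dU n x xab).
  by exists l.
have hu' n x : a <= x <= b -> `|u x - U n x| <= 2 * M0 / 2 ^+ n * expR (L * x).
  by move=> xab; apply: le_trans (hu x xab n) _; rewrite !mulrA [leRHS]mulrAC.
have cu : {within `[a, b], continuous u}.
  apply: approx_within_continuous => e e0.
  have [n hn] := half_exp_small (2 * (M0 * expR (L * b))) e0.
  exists (U n) => // x; rewrite /= in_itv /= => /[dup] xab /andP[ax xb].
  apply: (le_trans (hu x xab n)); apply: (le_trans _ hn).
  rewrite ler_pM2r ?invr_gt0 ?exprn_gt0// ler_pM2l//.
  by apply: ler_wpM2l => //; rewrite ler_expR ler_pM2l.
have Tu x : a <= x <= b -> T u x = u x.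
  move=> xab; apply/eqP; rewrite -subr_eq0 -normr_le0; apply/ler_addgt0Pr => e e0.
  rewrite add0r.
  have [n hn] := half_exp_small (2 * (2 * M0 * expR (L * x))) e0.
  have c0 : 0 <= 2 * M0 / 2 ^+ n by rewrite divr_ge0 ?mulr_ge0 ?exprn_ge0.
  have h1 := contr u (U n) _ cu (cU n) c0 (hu' n) x xab.
  have h2 := hu' n.+1 x xab; rewrite distrC in h2.
  apply: (le_trans (ler_distD (T (U n) x) _ _)); apply: (le_trans (lerD h1 h2)).
  apply: le_trans hn; rewrite exprSr.
  have -> : 2 * M0 / 2 ^+ n / 2 * expR (L * x) + 2 * M0 / (2 ^+ n * 2) * expR (L * x) =
     2 * M0 * expR (L * x) / 2 ^+ n.
    by field; rewrite expf_neq0.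
  by rewrite ler_pM2r ?invr_gt0 ?exprn_gt0//; have := expR_gt0 (L * x); nra.
exists u, (V u); split.
- split; last exact: hV.
  exact: pw_deriv_ext Tu (hT _ cu).
- by rewrite -Tu ?lexx// /T P_a addr0.
- by rewrite /V P_a addr0.
Qed.

End Picard.

(** * Exponential growth through the region where V is positive *)

Section Tunnelling.
Variable R : realType.
Implicit Types (S : seq R) (a b x y : R) (f g W u v V : R -> R).

(** Continuous induction: [step] passes positivity to the supremum of the good points, and
    continuity then carries it strictly beyond. It serves estimates that hold only while the
    function is positive. *)
Lemma first_exit a b f : {within `[a, b], continuous f} ->
  0 < f a ->
  (forall x, a < x <= b -> (forall y, a <= y < x -> 0 < f y) -> 0 < f x) ->
  forall x, a <= x <= b -> 0 < f x.
Proof.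
move=> cf fa step x0 /[dup] x0ab /andP[ax0 x0b].
have ab : a <= b := le_trans ax0 x0b.
pose E : set R := [set x | a <= x <= b /\ forall y, a <= y <= x -> 0 < f y].
have Ea : E a.
  by split; [rewrite lexx|move=> y; rewrite -eq_le => /eqP <-].
have Eub : ubound E b by move=> x [] /andP[].
have supE : has_sup E by split; [exists a|exists b].
pose s := sup E.
have as_ : a <= s by apply: ub_le_sup => //; exists b.
have sb : s <= b by apply: ge_sup => //; exists a.
have below y : a <= y < s -> 0 < f y.
  move=> /andP[ay ys]; have [z Ez] := sup_adherent (eps := s - y) ltac:(by rewrite subr_gt0) supE.
  rewrite -/s opprB addrCA subrr addr0 => yz.
  by apply: (proj2 Ez); rewrite ay ltW.
have fs : 0 < f s.
  move: as_; rewrite le_eqVlt => /predU1P[<-//|as_].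
  by apply: step => //; rewrite as_.
have {}sb : s = b.
  apply/eqP; rewrite eq_le sb leNgt; apply/negP => {}sb.
  have sab : `[a, b]%classic s by rewrite /= in_itv /= as_ ltW.
  move/subspace_continuousP: cf => /(_ s sab) /cvgrPdist_lt /(_ (f s) fs).
  rewrite near_withinE => /nbhs_ballP [d /= d0 hd].
  pose m := Num.min (s + d / 2) b.
  have sm : s < m by rewrite /m lt_min sb andbT; lra.
  have : E m.
    split; first by rewrite (le_trans as_ (ltW sm)) /m ge_min lexx orbT.
    move=> y /andP[ay ym]; have [ys|sy] := ltP y s; first by apply: below; rewrite ay.
    have : `|f s - f y| < f s.
      apply: hd.
        rewrite /ball /= distrC ger0_norm ?subr_ge0//.
        move: ym; rewrite /m le_min => /andP[]; lra.
      by rewrite /= in_itv /= ay (le_trans ym) // /m ge_min lexx orbT.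
    by rewrite ltr_norml => /andP[_]; rewrite ltrBlDr -ltrBlDl subrr.
  by move=> /(ub_le_sup (ex_intro _ b Eub)); rewrite leNgt -/s sm.
move: x0b; rewrite le_eqVlt -sb => /predU1P[->//|x0s].
by apply: below; rewrite ax0.
Qed.

(* For a solution [u] of h^2 u'' = (V + k^2) u, take p = (h u' + k u) e^(-kx/h)
   and q = u e^(kx/h).  The dependence on [eta] leaves room for slopes slightly
   below that of the decaying exponential: the contribution of V on
   ]a1, a2[ to [p] outweighs [eta]. *)
Lemma pq_growth S A a1 a2 c h k eta V p q :
  0 <= a1 -> a1 < a2 -> a2 < A -> 0 < c -> 0 < h -> 0 < k -> 0 <= eta ->
  (forall x, 0 < x < A -> 0 <= V x) ->
  (forall x, a1 < x < a2 -> c <= V x) ->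
  let kh := 2 * (k / h) in
  let p0 := c * (a2 - a1) / (4 * h) * expR (- (kh * a2)) in
  eta <= k * expR (- (kh * a2)) -> eta <= p0 ->
  pw_deriv S 0 A p (fun x => V x / h * expR (- (kh * x)) * q x) ->
  pw_deriv S 0 A q (fun x => h^-1 * expR (kh * x) * p x) ->
  - eta <= p 0 -> q 0 = 1 ->
  forall x, a2 <= x <= A -> p0 / (2 * k) * (expR (kh * x) - expR (kh * a2)) <= q x.
Proof.
move=> a1_ge0 a12 a2A c0 h0 k0 eta0 V0 Vc kh p0 eta_k eta_p hp hq p_0 q_0.
have kh0 : 0 < kh by rewrite mulr_gt0// divr_gt0.
have p0_gt0 : 0 < p0.
  by rewrite mulr_gt0 ?expR_gt0// divr_gt0 ?mulr_gt0// subr_gt0.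
have h_neq0 : h != 0 by rewrite gt_eqF.
have k_neq0 : k != 0 by rewrite gt_eqF.
have hE d : pw_deriv S 0 A (fun x => d / (2 * k) * expR (kh * x)) (fun x => d / h * expR (kh * x)).
  apply: pw_deriv_eq (pw_derivZ (d / (2 * k)) (pw_deriv_exp S 0 A kh)) => x _ _.
  by rewrite /kh; field; rewrite h_neq0.
have pmono x y : 0 <= x -> x <= y -> y <= A -> (forall z, 0 <= z < y -> 0 < q z) -> p x <= p y.
  move=> x0_ xy yA qpos.
  apply: (pw_deriv_ndecr xy (pw_deriv_sub x0_ yA hp)) => z /andP[xz zy] _.
  apply: mulr_ge0; last by apply/ltW/qpos; rewrite zy andbT (le_trans x0_ (ltW xz)).
  rewrite mulr_ge0 ?expR_ge0// divr_ge0// ?(ltW h0)// V0//.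
  by rewrite (le_lt_trans x0_ xz) (lt_le_trans zy yA).
have qlow d x y : 0 <= x -> x <= y -> y <= A -> (forall z, x <= z <= y -> d <= p z) ->
    d / (2 * k) * expR (kh * y) - d / (2 * k) * expR (kh * x) <= q y - q x.
  move=> x0_ xy yA dp.
  apply: (pw_deriv_le (pw_deriv_sub x0_ yA (hE d)) (pw_deriv_sub x0_ yA hq)) => // z /andP[xz zy] _.
  have -> : d / h * expR (kh * z) = h^-1 * expR (kh * z) * d by ring.
  rewrite ler_pM2l ?mulr_gt0 ?invr_gt0 ?expR_gt0//; apply: dp.
  by rewrite !ltW.
(* While q > 0, p is nondecreasing, hence at least - eta, and q loses at most eta / (2 k) (e^(kh x)
   - 1) <= 1/2. So q cannot reach 0 before a2. *)
have qhalf x : 0 <= x -> x <= a2 -> (forall z, 0 <= z < x -> 0 < q z) -> 2^-1 <= q x.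
  move=> x0_ xa2 qpos; have xA : x <= A := le_trans xa2 (ltW a2A).
  have := qlow (- eta) 0 x (lexx 0) x0_ xA.
  rewrite mulr0 expR0 mulr1 q_0 => /(_ _) H.
  have {H} := H; have -> : - eta / (2 * k) = - (eta / k / 2) by field.
  move=> /(_ _) H.
  have {H} : - (eta / k / 2) * expR (kh * x) - - (eta / k / 2) <= q x - 1.
    apply: H => z /andP[z0 zx]; apply: (le_trans p_0).
    apply: pmono => //; first exact: le_trans zx xA.
    by move=> y /andP[y0 yz]; apply: qpos; rewrite y0 (lt_le_trans yz).
  have e1 : eta / k * expR (kh * x) <= 1.
    apply: (@le_trans _ _ (expR (- (kh * a2)) * expR (kh * x))).
      by rewrite ler_pM2r ?expR_gt0// ler_pdivrMr// mulrC.
    rewrite -expRD -[leRHS]expR0 ler_expR addrC subr_le0 ler_pM2l//.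
  have e2 : 0 <= eta / k by rewrite divr_ge0// ltW.
  lra.
have q_pos1 x : 0 <= x <= a2 -> 0 < q x.
  apply: first_exit; rewrite ?q_0//.
    exact: (proj1 (pw_deriv_sub (lexx 0) (ltW a2A) hq)).
  move=> y /andP[y0 ya2] hy; apply: (@lt_le_trans _ _ 2^-1); first lra.
  by apply: qhalf => //; exact: ltW.
have a2_ge0 : 0 <= a2 by rewrite (le_trans a1_ge0 (ltW a12)).
have qh x : 0 <= x <= a2 -> 2^-1 <= q x.
  move=> /andP[x0_ xa2]; apply: qhalf => // z /andP[z0 zx].
  by apply: q_pos1; rewrite z0 (le_trans (ltW zx)).
(* On ]a1, a2[ the bounds V >= c and q >= 1/2 raise p by at least 2 p0; one half of this pays for
   the initial deficit eta <= p0. *)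
have pa2 : p0 <= p a2.
  have h1 : p 0 <= p a1.
    apply: pmono => //; first exact: le_trans (ltW a12) (ltW a2A).
    by move=> z /andP[z0 zx]; apply: q_pos1; rewrite z0 (le_trans (ltW zx) (ltW a12)).
  have h2 : 2 * p0 / (a2 - a1) * a2 - 2 * p0 / (a2 - a1) * a1 <= p a2 - p a1.
    apply: (pw_deriv_le (pw_derivZ (2 * p0 / (a2 - a1)) (pw_deriv_id S a1 a2)) (pw_deriv_sub a1_ge0 (ltW a2A) hp) _ (lexx a1) (ltW a12) (lexx a2)).
    move=> z /[dup] za /andP[a1z za2] _; rewrite mulr1.
    have -> : 2 * p0 / (a2 - a1) = c / h * expR (- (kh * a2)) * 2^-1.
      by rewrite /p0; field; rewrite h_neq0 subr_eq0 gt_eqF.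
    have ch0 : 0 <= c / h by rewrite ltW// divr_gt0.
    apply: ler_pM; first exact: mulr_ge0 ch0 (expR_ge0 _); first by rewrite invr_ge0.
      apply: ler_pM; rewrite ?expR_ge0//.
        by rewrite ler_pM2r ?invr_gt0// Vc.
      by rewrite ler_expR lerN2 ler_pM2l// ltW.
    by apply: qh; rewrite (le_trans a1_ge0 (ltW a1z)) ltW.
  move: h2; rewrite -mulrBr divfK ?subr_eq0 ?gt_eqF// => h2; lra.
have q_pos x : 0 <= x <= A -> 0 < q x.
  apply: first_exit; rewrite ?q_0//; first exact: (proj1 hq).
  move=> y /andP[y0 yA] hy; have [ya2|a2y] := leP y a2; first by apply: q_pos1; rewrite ltW.
  have := qlow 0 a2 y a2_ge0 (ltW a2y) yA.
  rewrite !mul0r subrr => /(_ _) H; apply: (@lt_le_trans _ _ (q a2)); first by apply: q_pos1; rewrite a2_ge0 lexx.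
  rewrite -subr_ge0; apply: H => z /andP[a2z zy].
  apply: (le_trans (ltW p0_gt0)); apply: (le_trans pa2); apply: pmono => //.
    exact: le_trans zy yA.
  by move=> t /andP[t0 tz]; apply: hy; rewrite t0 (lt_le_trans tz).
move=> x /andP[a2x xA].
have := qlow p0 a2 x a2_ge0 a2x xA => /(_ _) H.
have {H} : p0 / (2 * k) * expR (kh * x) - p0 / (2 * k) * expR (kh * a2) <= q x - q a2.
  apply: H => z /andP[a2z zx]; apply: (le_trans pa2); apply: pmono => //.
    exact: le_trans zx xA.
  by move=> t /andP[t0 tz]; apply: q_pos; rewrite t0 (le_trans (ltW tz)) // (le_trans zx).
have : 0 < q a2 by apply: q_pos; rewrite a2_ge0 ltW.
by rewrite mulrBr; lra.
Qed.

Lemma ode_growth S A a1 a2 c h k eta V u v :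
  0 <= a1 -> a1 < a2 -> a2 < A -> 0 < c -> 0 < h -> 0 < k -> 0 <= eta ->
  (forall x, 0 < x < A -> 0 <= V x) ->
  (forall x, a1 < x < a2 -> c <= V x) ->
  let kh := 2 * (k / h) in
  let p0 := c * (a2 - a1) / (4 * h) * expR (- (kh * a2)) in
  eta <= k * expR (- (kh * a2)) -> eta <= p0 ->
  ode_sol S 0 A (fun x => (V x + k ^+ 2) / h ^+ 2) u v ->
  u 0 = 1 -> - (k + eta) <= h * v 0 ->
  forall x, a2 <= x <= A ->
    p0 / (2 * k) * (expR (kh * x) - expR (kh * a2)) <= u x * expR (k / h * x).
Proof.
move=> a1_ge0 a12 a2A c0 h0 k0 eta0 V0 Vc kh p0 eta_k eta_p [hu hv] u0 v0.
have h_neq0 : h != 0 by rewrite gt_eqF.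
apply: (@pq_growth S A a1 a2 c h k eta V (fun x => (h * v x + k * u x) * expR (- (k / h) * x))
  (fun x => u x * expR (k / h * x))) => //.
- apply: pw_deriv_eq (pw_derivM (pw_derivD (pw_derivZ h hv) (pw_derivZ k hu)) (pw_deriv_exp S 0 A (- (k / h)))) => x _ _.
  have -> : - (2 * (k / h) * x) = - (k / h) * x + - (k / h) * x by ring.
  rewrite expRD; have -> : - (k / h) * x = - (k / h * x) by ring.
  rewrite expRN; field; rewrite h_neq0 gt_eqF ?expR_gt0//.
- apply: pw_deriv_eq (pw_derivM hu (pw_deriv_exp S 0 A (k / h))) => x _ _.
  have -> : 2 * (k / h) * x = k / h * x + k / h * x by ring.
  rewrite expRD; have -> : - (k / h) * x = - (k / h * x) by ring.
  rewrite expRN; field; rewrite h_neq0 gt_eqF ?expR_gt0//.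
- rewrite mulr0 expR0 mulr1 u0; lra.
- by rewrite mulr0 expR0 mulr1.
Qed.

End Tunnelling.

(** * Forcing the slope b/a to reach a moving target *)

Section Crossing.
Variable R : realType.
Implicit Types (a b : R -> R) (Q : R -> R -> R).

(** Neither a nor b is assumed differentiable: the identity for Q turns the difference quotient of
    the ratio into an expression continuous at x, which is Caratheodory's criterion. *)
Lemma is_derive_ratio a b Q th x :
  {for x, continuous a} -> {for x, continuous b} -> {for x, continuous (Q x)} ->
  (forall y, a y * b x - a x * b y = (y - x) * Q x y) ->
  b x - th * x * a x != 0 ->
  is_derive x 1 (fun y => a y / (b y - th * y * a y))
    ((Q x x + th * a x ^+ 2) / (b x - th * x * a x) ^+ 2).
Proof.
move=> ca cb cQ HQ; set G := fun y => b y - th * y * a y => Gx.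
rewrite -/(G x) in Gx *.
have cG : {for x, continuous G}.
  apply: continuousB => //; apply: continuousM => //.
  by apply: continuousM; [exact: cst_continuous|exact: cvg_id].
pose g y := (Q x y + th * (a x * a y)) / (G x * G y).
apply/is_derive1_caratheodory.
(* Where G vanishes the ratio is 0 by convention, and the raw difference quotient is taken; this
   happens away from x only and does not affect continuity there. *)
exists (fun y => if G y == 0 then (a y / G y - a x / G x) / (y - x) else g y); split.
- move=> y; case: ifPn => [/eqP Gy|Gy].
    rewrite divfK// subr_eq0; apply: contra Gx => /eqP <-; exact/eqP.
  rewrite /g; have -> : a y / G y - a x / G x = (a y * G x - a x * G y) / (G x * G y).
    by field; rewrite Gx Gy.
  have -> : a y * G x - a x * G y = (y - x) * (Q x y + th * (a x * a y)).
    by rewrite [RHS]mulrDr -HQ /G; ring.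
  by rewrite -mulrA mulrC.
- have cg : {for x, continuous g}.
    apply: continuousM.
      apply: continuousD => //; apply: continuousM; first exact: cst_continuous.
      by apply: continuousM => //; exact: cst_continuous.
    apply: continuousV; first by rewrite mulf_neq0.
    by apply: continuousM => //; exact: cst_continuous.
  rewrite /prop_for /continuous_at /= (negbTE Gx).
  apply: cvg_trans cg; apply: near_eq_cvg.
  have Gnear : \forall y \near x, G y != 0 by exact: cvgr_neq0 cG _.
  by near=> y; rewrite ifN//; near: y.
- by rewrite (negbTE Gx) /g !expr2.
Unshelve. all: by end_near. Qed.

(* Here [- Q t t] is the Wronskian b' a - a' b in the parameter.
   The ratio [r = a / (b - th t a)] satisfies [r' >= (M - 1) r ^ 2] as long as
   it stays positive, so it would blow up before [s + e]. *)
Lemma no_positive_gap a b Q s e K M m0 th : 0 < e ->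
  (forall t, {for t, continuous a}) -> (forall t, {for t, continuous b}) ->
  (forall t, {for t, continuous (Q t)}) ->
  (forall t1 t2, a t2 * b t1 - a t1 * b t2 = (t2 - t1) * Q t1 t2) ->
  (forall t, s <= t <= s + e -> `|b t| <= K * `|a t| -> M * a t ^+ 2 <= Q t t) ->
  b s = m0 * a s -> -1 <= th ->
  0 < m0 - th * s <= (M - 1) * e ->
  (forall t, s <= t <= s + e -> - K <= th * t <= K - (m0 - th * s) - e) ->
  ~ (forall t, s <= t <= s + e -> 0 < b t - th * t * a t).
Proof.
move=> e0 ca cb cQ HQ HM bs th1; set d := m0 - th * s => /andP[d0 dM] Kth Gpos.
pose G t := b t - th * t * a t.
pose r t := a t / G t.
have G0 t : s <= t <= s + e -> 0 < G t by exact: Gpos.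
have dr t : s <= t <= s + e ->
    is_derive t 1 r ((Q t t + th * a t ^+ 2) / G t ^+ 2).
  move=> tI; apply: is_derive_ratio => //.
  by rewrite -/(G t) gt_eqF// G0.
have sI : s <= s <= s + e by rewrite lexx lerDl ltW.
have Gs : G s = d * a s by rewrite /G bs -mulrBl.
have as0 : 0 < a s by have := G0 s sI; rewrite Gs pmulr_rgt0.
have rs : r s = d^-1 by rewrite /r Gs; field; rewrite !gt_eqF.
have hr : pw_deriv [::] s (s + e) r (fun t => (Q t t + th * a t ^+ 2) / G t ^+ 2).
  split; last by move=> t /andP[h1 h2] _; apply: dr; rewrite !ltW.
  apply: derivable_within_continuous => t; rewrite in_itv /= => /dr h.
  exact: ex_derive.
(* The initial value d^-1 of r exceeds c strictly, which leaves room for a first exit argument. For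
   r > c the slope b/a exceeds th t by less than d + e, hence stays below K. *)
pose c := (d + e)^-1.
have de0 : 0 < d + e by exact: addr_gt0.
have c0 : 0 < c by rewrite invr_gt0.
have growth t : s <= t <= s + e -> c < r t ->
    (M - 1) * r t ^+ 2 <= (Q t t + th * a t ^+ 2) / G t ^+ 2.
  move=> tI crt; have Gt := G0 t tI; have rt0 := lt_trans c0 crt.
  have at0 : 0 < a t by rewrite -(pmulr_lgt0 _ (x := (G t)^-1)) ?invr_gt0.
  have Gad : G t <= (d + e) * a t.
    rewrite -ler_pdivrMl// -/c -ler_pdivlMr ?ltW//.
  have HMt : M * a t ^+ 2 <= Q t t.
    apply: HM => //; rewrite (gtr0_norm at0) ler_norml.
    have /andP[K1 K2] := Kth t tI; move: Gt Gad; rewrite /G => Gt Gad.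
    by apply/andP; split; nra.
  rewrite /r expr_div_n mulrA ler_pM2r ?invr_gt0 ?exprn_gt0//.
  have := sqr_ge0 (a t); nra.
have M1 : 0 <= M - 1.
  have := lt_le_trans d0 dM; rewrite pmulr_lgt0// => /ltW; exact.
have rc t : s <= t <= s + e -> 0 < r t - c.
  apply: (@first_exit R s (s + e) (fun t => r t - c)).
  - exact: (proj1 (pw_derivB hr (pw_deriv_cst [::] s (s + e) c))).
  - by rewrite rs subr_gt0 ltf_pV2 ?posrE//; lra.
  move=> x /andP[sx xe] hx.
  have : r s <= r x.
    apply: (pw_deriv_ndecr (ltW sx) (pw_deriv_sub (lexx s) xe hr)) => z /andP[sz zx] _.
    have zI : s <= z <= s + e by rewrite ltW//= (le_trans (ltW zx)).
    have crz : c < r z by rewrite -subr_gt0; apply: hx; rewrite (ltW sz).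
    by apply: le_trans (growth z zI crz); rewrite mulr_ge0 ?sqr_ge0.
  have : c < r s by rewrite rs ltf_pV2 ?posrE//; lra.
  lra.
have rt0 t : s <= t <= s + e -> 0 < r t by move=> /rc; lra.
(* The Riccati inequality is linear in - 1/r: starting from - d, this function would gain at least
   (M - 1) e >= d over the interval, yet it has to remain negative. *)
have hi : pw_deriv [::] s (s + e) (fun t => - (r t)^-1)
    (fun t => (Q t t + th * a t ^+ 2) / G t ^+ 2 / r t ^+ 2).
  have dri t : s <= t <= s + e -> is_derive t 1 (fun z => - (r z)^-1)
     ((Q t t + th * a t ^+ 2) / G t ^+ 2 / r t ^+ 2).
    move=> tI; apply: is_derive_eq.
      apply: is_deriveN; apply: is_deriveV; last exact: dr.
      by rewrite gt_eqF// rt0.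
    by rewrite /GRing.scale /= mulNr opprK mulrC.
  split; last by move=> t /andP[h1 h2] _; apply: dri; rewrite !ltW.
  apply: derivable_within_continuous => t; rewrite in_itv /= => /dri h.
  exact: ex_derive.
have ses : s <= s + e by rewrite lerDl ltW.
have := pw_deriv_le (pw_derivZ (M - 1) (pw_deriv_id [::] s (s + e))) hi _ (lexx s) ses (lexx (s + e)) => /(_ _) H.
have {H} : (M - 1) * (s + e) - (M - 1) * s <= - (r (s + e))^-1 - - (r s)^-1.
  apply: H => t /andP[h1 h2] _.
  have tI : s <= t <= s + e by rewrite !ltW.
  rewrite mulr1 ler_pdivlMr ?exprn_gt0 ?rt0//; apply: growth => //.
  by rewrite -subr_gt0 rc.
rewrite rs invrK -mulrBr addrAC subrr add0r.
have : 0 < (r (s + e))^-1 by rewrite invr_gt0 rt0// lexx andbT.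
lra.
Qed.

(** Without a crossing, b - th t a has a constant sign by the intermediate value theorem. The
    negative sign reduces to the positive one by changing (a, b) to (- a, - b), which leaves Q
    unchanged. *)
Lemma cone_crossing a b Q s e K M m0 th : 0 < e ->
  (forall t, {for t, continuous a}) -> (forall t, {for t, continuous b}) ->
  (forall t, {for t, continuous (Q t)}) ->
  (forall t1 t2, a t2 * b t1 - a t1 * b t2 = (t2 - t1) * Q t1 t2) ->
  (forall t, s <= t <= s + e -> `|b t| <= K * `|a t| -> M * a t ^+ 2 <= Q t t) ->
  b s = m0 * a s -> -1 <= th ->
  0 < m0 - th * s <= (M - 1) * e ->
  (forall t, s <= t <= s + e -> - K <= th * t <= K - (m0 - th * s) - e) ->
  exists2 t, s <= t <= s + e & b t = th * t * a t.
Proof.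
move=> e0 ca cb cQ HQ HM bs th1 dM Kth; apply: contrapT => noz.
pose G t := b t - th * t * a t.
have cG t : {for t, continuous G}.
  apply: continuousB => //; apply: continuousM => //.
  by apply: continuousM; [exact: cst_continuous|exact: cvg_id].
have nz t : s <= t <= s + e -> G t != 0.
  by move=> tI; apply/negP; rewrite subr_eq0 => /eqP Gt; apply: noz; exists t.
have sI : s <= s <= s + e by rewrite lexx lerDl ltW.
have sgn t : s <= t <= s + e -> 0 < G s * G t.
  move=> tI; rewrite ltNge; apply/negP => Gst; have /andP[st te] := tI.
  have [||c cI Gc] := @IVT R G s t 0 st.
  - by apply: continuous_subspaceT => x; exact: cG.
  - rewrite ge_min le_max; move: Gst.
    by case: (leP (G s) 0) => h1; case: (leP (G t) 0) => h2; rewrite ?(ltW h1) ?(ltW h2) //=; nra.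
  move: cI; rewrite in_itv /= => /andP[sc ct].
  by have := nz c; rewrite sc (le_trans ct te) Gc eqxx => /(_ isT).
have [Gs|Gs] := ltP 0 (G s).
  apply: (no_positive_gap e0 ca cb cQ HQ HM bs th1 dM Kth) => t tI.
  by have := sgn t tI; rewrite pmulr_rgt0.
have {}Gs : G s < 0 by rewrite lt_neqAle nz.
apply: (@no_positive_gap (fun t => - a t) (fun t => - b t) Q s e K M m0 th) => //.
- by move=> t; apply: continuousN; exact: ca.
- by move=> t; apply: continuousN; exact: cb.
- by move=> t1 t2; rewrite -HQ; ring.
- by move=> t tI; rewrite !normrN sqrrN; exact: HM.
- by rewrite bs mulrN.
- move=> t tI; have := sgn t tI; rewrite nmulr_rgt0// /G; lra.
Qed.

End Crossing.

(** * The mass of a solution compared with its value at 0 *)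

Section TunnellingEstimate.
Variable R : realType.
Implicit Types (S : seq R) (V u v F : R -> R).

Lemma subinterval_avoiding S (a b : R) : a < b ->
  exists a' b', [/\ a <= a', a' < b', b' <= b & forall x, a' < x < b' -> x \notin S].
Proof.
elim: S a b => [|s S IH] a b ab; first by exists a, b; rewrite !lexx.
have [a' [b' [aa ab' bb xS]]] := IH a b ab.
have [/andP[as_ sb]|sab] := boolP (a' < s < b').
  exists a', s; split=> //; first exact: le_trans (ltW sb) bb.
  move=> x /andP[h1 h2]; rewrite inE negb_or lt_eqF//=.
  by apply: xS; rewrite h1 (lt_trans h2).
exists a', b'; split=> // x xab; rewrite inE negb_or xS// andbT.
by apply: contra sab => /eqP <-.
Qed.

(** Pointwise positivity gives no uniform lower bound, as V may tend to 0 at 0 or at a jump; one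
    continuity point provides an interval with V >= c. *)
Lemma positive_on_subinterval S (A : R) V : 0 < A ->
  (forall x, 0 < x < A -> x \notin S -> {for x, continuous V}) ->
  (forall x, 0 < x < A -> 0 < V x) ->
  exists a1 a2 c, [/\ 0 <= a1, a1 < a2, a2 < A, 0 < c &
    forall x, a1 < x < a2 -> c <= V x].
Proof.
move=> A0 cV V0; have [a [b [a0 ab bA abS]]] := subinterval_avoiding S A0.
pose m := (a + b) / 2.
have am : a < m by rewrite /m; lra.
have mb : m < b by rewrite /m; lra.
have m0A : 0 < m < A by apply/andP; split; lra.
have Vm := V0 m m0A.
have := cV m m0A (abS m ltac:(by rewrite am)).
move=> /cvgrPdist_lt /(_ (V m / 2) ltac:(lra)) /nbhs_ballP [d /= d0 hd].
pose l := Num.min d (b - m).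
have l0 : 0 < l by rewrite lt_min d0 subr_gt0.
have ld : l <= d by rewrite ge_min lexx.
have lb : l <= b - m by rewrite ge_min lexx orbT.
exists m, (m + l / 2), (V m / 2); split; [lra|lra|lra|lra|].
move=> x /andP[h1 h2].
have : `|V m - V x| < V m / 2.
  by apply: hd; rewrite /ball /= distrC gtr0_norm ?subr_gt0//; lra.
by rewrite ltr_norml => /andP[]; lra.
Qed.

(** Here [F B - F 0] is the integral of u^2. Only [A/2, A] is used for the lower bound, since u has
    grown there by at least a factor of order e^(sigma/(2h)); beyond A, the primitive is merely
    nondecreasing. *)
Lemma tunnelling S (A B kl kr : R) V : 0 < A <= B -> 0 < kl <= kr ->
  (forall x, 0 < x < A -> x \notin S -> {for x, continuous V}) ->
  (forall x, 0 < x < A -> 0 < V x) ->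
  exists c1 c2 sigma h0, [/\ 0 < c1, 0 < c2, 0 < sigma, 0 < h0 &
    forall h k u v F, 0 < h < h0 -> kl <= k <= kr ->
      ode_sol S 0 B (fun x => (V x + k ^+ 2) / h ^+ 2) u v ->
      pw_deriv S 0 B F (fun x => u x ^+ 2) ->
      `|h * v 0| <= (k + c2 * expR (- (sigma / 4 / h))) * `|u 0| ->
      c1 * expR (sigma / h) * u 0 ^+ 2 <= F B - F 0].
Proof.
move=> /andP[A0 AB] /andP[kl0 klr] cV V0.
have kr0 : 0 < kr by exact: lt_le_trans klr.
pose sigma := kl * A / 2.
have sigma0 : 0 < sigma by rewrite divr_gt0// mulr_gt0.
(* The interval ]a1, a2[ is placed near 0: the second bound gives 2 k a2 <= sigma / 4, so that the
   tolerance e^(-sigma/(4h)) is below e^(-kh a2); the first keeps the loss 2 a2 in the growth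
   exponent below A/8. *)
pose A' := Num.min (A / 16) (sigma / (8 * kr)).
have A'0 : 0 < A'.
  by rewrite lt_min; apply/andP; split; rewrite divr_gt0// mulr_gt0.
have A'A : A' <= A / 16 by rewrite ge_min lexx.
have A's : A' <= sigma / (8 * kr) by rewrite ge_min lexx orbT.
have [|||a1 [a2 [c [a1_ge0 a12 a2A c0 Vc]]]] := @positive_on_subinterval S A' V.
- by [].
- by move=> x /andP[x0 xA]; apply: cV; rewrite x0; lra.
- by move=> x /andP[x0 xA]; apply: V0; rewrite x0; lra.
have a2A_ : a2 < A by lra.
have a2_gt0 : 0 < a2 by lra.
have l0 : 0 < a2 - a1 by rewrite subr_gt0.
(* The two entries ensure eta <= k e^(-kh a2) and, as h < 1, eta <= p0. *)
pose c2 := Num.min kl (c * (a2 - a1) / 4).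
have c2_gt0 : 0 < c2 by rewrite lt_min kl0 divr_gt0// mulr_gt0.
pose D := c * (a2 - a1) / (16 * kr).
have D0 : 0 < D by rewrite divr_gt0 ?mulr_gt0.
pose c1 := A / 2 * D ^+ 2.
have c1_gt0 : 0 < c1 by rewrite mulr_gt0 ?exprn_gt0// divr_gt0.
(* For x >= A/2 one has x - a2 >= 7 A / 16, so the second bound on h gives kh (x - a2) >= 1 and
   hence e^(kh x) >= 2 e^(kh a2). *)
exists c1, c2, sigma, (Num.min 1 (kl * A * 7 / 8)); split=> //.
  by rewrite lt_min ltr01 divr_gt0// !mulr_gt0.
move=> h k u v F /andP[h0]; rewrite lt_min => /andP[h1 hkA] /andP[klk kkr] [hu hv] hF.
have k0 : 0 < k by exact: lt_le_trans klk.
have h_neq0 : h != 0 by rewrite gt_eqF.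
set eta := c2 * _ => huv.
have eta0 : 0 <= eta by rewrite ltW// mulr_gt0 ?expR_gt0.
have Fmono x y : 0 <= x -> x <= y -> y <= B -> F x <= F y.
  move=> x0 xy yB; apply: (pw_deriv_ndecr xy (pw_deriv_sub x0 yB hF)) => z _ _.
  exact: sqr_ge0.
have [u0|u0] := eqVneq (u 0) 0.
  by rewrite u0 expr0n /= mulr0 subr_ge0 Fmono// (le_trans (ltW A0)).
pose kh := 2 * (k / h).
have kh0 : 0 < kh by rewrite mulr_gt0// divr_gt0.
have ex1 : expR (- (sigma / 4 / h)) <= expR (- (kh * a2)).
  rewrite ler_expR lerN2 ler_pdivlMr//.
  have -> : kh * a2 * h = 2 * k * a2 by rewrite /kh; field.
  have : a2 * (8 * kr) <= sigma by rewrite -ler_pdivlMr ?mulr_gt0//; lra.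
  have : k * a2 <= kr * a2 by rewrite ler_pM2r.
  lra.
pose p0 := c * (a2 - a1) / (4 * h) * expR (- (kh * a2)).
have eta_k : eta <= k * expR (- (kh * a2)).
  apply: ler_pM; rewrite ?expR_ge0 ?(ltW c2_gt0)//.
  by apply: le_trans klk; rewrite ge_min lexx.
have cl0 : 0 < c * (a2 - a1) by exact: mulr_gt0.
have hc : c * (a2 - a1) / 4 <= c * (a2 - a1) / (4 * h).
  rewrite ler_pM2l// lef_pV2 ?posrE ?mulr_gt0//; lra.
have eta_p : eta <= p0.
  apply: ler_pM; rewrite ?expR_ge0 ?(ltW c2_gt0)//.
  by apply: le_trans hc; rewrite ge_min lexx orbT.
(* The growth estimate is stated for value 1 at 0, so u is divided by u 0; the second summand is a
   dummy. *)
have solA : ode_sol S 0 A (fun x => (V x + k ^+ 2) / h ^+ 2)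
    (fun x => (u 0)^-1 * u x + 0 * u x) (fun x => (u 0)^-1 * v x + 0 * v x).
  by apply: ode_sol_comb; split; apply: pw_deriv_sub (lexx 0) AB _.
have := @ode_growth R S A a1 a2 c h k eta V _ _ a1_ge0 a12 a2A_ c0 h0 k0 eta0 _ Vc eta_k eta_p solA.
rewrite /= mul0r addr0 mulVf// => /(_ _ erefl _) H.
have {H} grow x : a2 <= x <= A ->
    p0 / (2 * k) * (expR (kh * x) - expR (kh * a2)) <= (u 0)^-1 * u x * expR (k / h * x).
  move=> xI; have := H _ _ x xI; rewrite !mul0r !addr0; apply.
    by move=> y /V0; exact: ltW.
  have : `|(u 0)^-1 * (h * v 0)| <= k + eta.
    by rewrite normrM normfV ler_pdivrMl ?normr_gt0// [leRHS]mulrC.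
  by rewrite ler_norml => /andP[]; rewrite mulrCA.
(* After division by e^(k x/h) there remains p0 / (4 k) e^(k x/h). The exponent k (x - 2 a2) / h is
   at least 3 kl A / (8 h), which exceeds sigma / (2 h). *)
have low x : A / 2 <= x <= A -> D * expR (sigma / 2 / h) <= (u 0)^-1 * u x.
  move=> /andP[Ax xA]; have := grow x => /(_ _) H.
  have {H} := H ltac:(by apply/andP; split; clear -Ax xA a2A A'A A0; lra).
  have e2 : 2 * expR (kh * a2) <= expR (kh * x).
    have -> : kh * x = kh * (x - a2) + kh * a2 by ring.
    rewrite expRD ler_pM2r ?expR_gt0//.
    have := expR_ge1Dx (kh * (x - a2)); apply: le_trans.
    suff : 1 <= kh * (x - a2) by clear; lra.
    have -> : kh * (x - a2) = 2 * k * (x - a2) / h by rewrite /kh; field.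
    rewrite ler_pdivlMr// mul1r.
    have : kl * (A * 7 / 16) <= k * (x - a2).
      by apply: ler_pM => //; clear -Ax a2A A'A A0 kl0; lra.
    clear -hkA; lra.
  have ekx : expR (kh * x) = expR (k / h * x) * expR (k / h * x).
    by rewrite -expRD; congr expR; rewrite /kh; ring.
  have P0 : 0 < p0 / (2 * k).
    apply: divr_gt0; last exact: mulr_gt0.
    by apply: mulr_gt0 (expR_gt0 _); apply: divr_gt0 => //; exact: mulr_gt0.
  move=> H; have {H} : p0 / (2 * k) * (expR (kh * x) / 2) <= (u 0)^-1 * u x * expR (k / h * x).
    apply: le_trans H; rewrite ler_pM2l//; lra.
  rewrite ekx [X in X <= _](_ : _ = p0 / (4 * k) * expR (k / h * x) * expR (k / h * x)); last first.
    by field; rewrite gt_eqF.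
  rewrite ler_pM2r ?expR_gt0// => H; apply: le_trans H.
  rewrite /p0.
  have -> : c * (a2 - a1) / (4 * h) * expR (- (kh * a2)) / (4 * k) * expR (k / h * x) =
     c * (a2 - a1) / (16 * (h * k)) * (expR (- (kh * a2)) * expR (k / h * x)).
    by field; rewrite h_neq0 gt_eqF.
  apply: ler_pM; rewrite ?expR_ge0 ?(ltW D0)//.
    rewrite ler_pM2l// lef_pV2 ?posrE ?mulr_gt0// ler_pM2l//.
    by rewrite -[leRHS]mul1r; apply: ler_pM => //; exact: ltW.
  rewrite -expRD ler_expR ler_pdivrMr//.
  have -> : (- (kh * a2) + k / h * x) * h = k * (x - 2 * a2) by rewrite /kh; field.
  have : kl * (A * 3 / 8) <= k * (x - 2 * a2).
    by apply: ler_pM => //; clear -Ax a2A A'A A0 kl0; lra.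
  by rewrite /sigma; have := mulr_gt0 kl0 A0; clear; lra.
have hF2 : pw_deriv S (A / 2) A F (fun x => u x ^+ 2).
  by apply: pw_deriv_sub hF; [clear -A0; lra|].
have u02 : 0 < u 0 ^+ 2 by rewrite lt_def sqrf_eq0 u0 sqr_ge0.
pose m := D ^+ 2 * expR (sigma / h) * u 0 ^+ 2.
have A2A : A / 2 <= A by clear -A0; lra.
have := pw_deriv_le (pw_derivZ m (pw_deriv_id S (A / 2) A)) hF2 _ (lexx _) A2A (lexx _).
move=> /(_ _) H; have {H} : m * A - m * (A / 2) <= F A - F (A / 2).
  apply: H => x /andP[x1 x2] _; rewrite mulr1 /m -ler_pdivlMr//.
  have -> : u x ^+ 2 / u 0 ^+ 2 = ((u 0)^-1 * u x) ^+ 2 by rewrite exprMn exprVn mulrC.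
  have -> : D ^+ 2 * expR (sigma / h) = (D * expR (sigma / 2 / h)) ^+ 2.
    by rewrite [RHS]exprMn [X in _ = _ * X]expr2 -expRD; congr (_ * expR _); field.
  rewrite ler_pXn2r ?nnegrE//; first by apply: low; rewrite !ltW.
    by rewrite mulr_ge0 ?expR_ge0 ?(ltW D0).
  apply: le_trans (low x _); first by rewrite mulr_ge0 ?expR_ge0 ?(ltW D0).
  by rewrite !ltW.
have -> : c1 * expR (sigma / h) * u 0 ^+ 2 = m * A - m * (A / 2) by rewrite /c1 /m; field.
have := Fmono A B (ltW A0) AB (lexx B); have := Fmono 0 (A / 2) (lexx 0).
have A20 : 0 <= A / 2 by clear -A0; lra.
have A2B : A / 2 <= B by clear -A0 AB; lra.
by move=> /(_ A20 A2B); clear; lra.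
Qed.

End TunnellingEstimate.

(** * The solution normalised at B and its dependence on k *)

Section Shooting.
Variable R : realType.
Implicit Types (S : seq R) (V u v f df : R -> R).
Local Notation mu := (@lebesgue_measure R).

Lemma pw_deriv_lip S a b M f df : a <= b -> pw_deriv S a b f df ->
  (forall x, a < x < b -> `|df x| <= M) -> `|f b - f a| <= M * (b - a).
Proof.
move=> ab hf dM; have hid := pw_derivZ M (pw_deriv_id S a b).
have h1 : f b - f a <= M * b - M * a.
  apply: (pw_deriv_le hf hid _ (lexx a) ab (lexx b)) => x /dM + _.
  by rewrite mulr1 ler_norml => /andP[].
have h2 : - f b - - f a <= M * b - M * a.
  apply: (pw_deriv_le (pw_derivN hf) hid _ (lexx a) ab (lexx b)) => x /dM + _.
  by rewrite mulr1 ler_norml => /andP[h _]; rewrite lerNl.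
rewrite ler_norml mulrBr; apply/andP; split; lra.
Qed.

Lemma lipschitz_at_continuous f x C :
  (forall y, `|y - x| <= 1 -> `|f y - f x| <= C * `|y - x|) ->
  {for x, continuous f}.
Proof.
move=> H; have C0 : 0 <= C.
  have := H (x + 1); rewrite addrC addKr normr1 mulr1 => /(_ (lexx 1)).
  exact: le_trans.
apply/cvgrPdist_le => e e0.
have eC : 0 < e / (C + 1) by rewrite divr_gt0// ltr_wpDl.
near=> y.
have y1 : `|y - x| <= 1.
  have : ball x 1 y by near: y; exact: (@nbhsx_ballx _ _ x 1 ltr01).
  by rewrite /ball /= distrC => /ltW.
rewrite distrC; apply: (le_trans (H y y1)).
have : `|y - x| <= e / (C + 1).
  have : ball x (e / (C + 1)) y by near: y; exact: (@nbhsx_ballx _ _ x _ eC).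
  by rewrite /ball /= distrC => /ltW.
rewrite ler_pdivlMr; last by rewrite ltr_wpDl.
apply: le_trans; rewrite mulrC ler_wpM2l//; lra.
Unshelve. all: by end_near. Qed.

Lemma pw_cont_potential S (a b h k : R) V : 0 < h -> pw_cont S a b V ->
  pw_cont S a b (fun x => (V x + k ^+ 2) / h ^+ 2).
Proof.
move=> h0 [[M VM] cV]; split.
  exists ((M + k ^+ 2) / h ^+ 2) => x xI.
  rewrite normrM normfV [`|h ^+ 2|]ger0_norm ?sqr_ge0// ler_pM2r ?invr_gt0 ?exprn_gt0//.
  apply: (le_trans (ler_normD _ _)); rewrite [`|k ^+ 2|]ger0_norm ?sqr_ge0// lerD2r.
  exact: VM.
move=> x xI xS; apply: continuousM; last exact: cst_continuous.
by apply: continuousD; [exact: cV|exact: cst_continuous].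
Qed.

Variables (S : seq R) (B h : R) (V : R -> R).
Hypotheses (B0 : 0 < B) (h0 : 0 < h) (hV : pw_cont S 0 B V).
Let W k x := (V x + k ^+ 2) / h ^+ 2.

(** The existence lemma prescribes data at the left end. The fundamental system normalised at 0 has
    constant Wronskian 1, which is what makes the chosen combination take the data (1, 0) at B. *)
Lemma shooting_exists k : exists u v,
  [/\ ode_sol S 0 B (W k) u v, u B = 1 & v B = 0].
Proof.
have [c [c' [hc c0 c'0]]] := ode_exists 1 0 (ltW B0) (pw_cont_potential k h0 hV).
have [s [s' [hs s0 s'0]]] := ode_exists 0 1 (ltW B0) (pw_cont_potential k h0 hV).
exists (fun x => s' B * c x + - c' B * s x), (fun x => s' B * c' x + - c' B * s' x).
split; first exact: ode_sol_comb; last by ring.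
have hw := wronskian_deriv hc hs.
have {}hw : pw_deriv S 0 B (fun x => c x * s' x - c' x * s x) (fun=> 0).
  by apply: pw_deriv_eq hw => x _ _; rewrite subrr mul0r.
have := pw_deriv_lip (M := 0) (ltW B0) hw (fun x _ => _).
rewrite mul0r c0 s0 c'0 s'0 => H.
have {H} : `|c B * s' B - c' B * s B - (1 * 1 - 0 * 0)| <= 0 by apply: H => x; rewrite normr0.
rewrite normr_le0 mulr0 mulr1 subr0 subr_eq0 => /eqP <-; ring.
Qed.

Variables (phi phi' : R -> R -> R).
Hypothesis phi_sol : forall k, ode_sol S 0 B (W k) (phi k) (phi' k).
Hypothesis phi_B : forall k, phi k B = 1.
Hypothesis phi'_B : forall k, phi' k B = 0.

Lemma W_bound K : exists2 w, 0 <= w & forall k x, `|k| <= K -> 0 < x < B -> `|W k x| <= w.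
Proof.
have [[M VM] _] := hV.
have M0 : 0 <= M by apply: le_trans (normr_ge0 (V 0)) (VM 0 _); rewrite lexx ltW.
exists ((M + K ^+ 2) / h ^+ 2); first by rewrite divr_ge0 ?addr_ge0 ?sqr_ge0.
move=> k x kK /andP[x0 xB]; rewrite normrM normfV [`|h ^+ 2|]ger0_norm ?sqr_ge0//.
rewrite ler_pM2r ?invr_gt0 ?exprn_gt0//; apply: (le_trans (ler_normD _ _)).
apply: lerD; first by apply: VM; rewrite !ltW.
rewrite normrX ler_pXn2r ?nnegrE//; exact: le_trans kK.
Qed.

Lemma shooting_unique k u v : ode_sol S 0 B (W k) u v -> v B = 0 ->
  forall x, 0 <= x <= B -> u x = u B * phi k x /\ v x = u B * phi' k x.
Proof.
move=> hu vB x xB; have [w w0 Ww] := W_bound `|k|.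
have [h1 h2] := ode_sol_comb 1 (- u B) hu (phi_sol k).
have h2' : pw_deriv S 0 B (fun x => 1 * v x + - u B * phi' k x)
   (fun x => W k x * (1 * u x + - u B * phi k x) + (fun=> 0) x).
  by apply: pw_deriv_eq h2 => y _ _; rewrite addr0.
have := ode_gronwall (ltW B0) w0 (fun x => Ww k x (lexx _)) (g := fun=> 0) (X := 0) _ h1 h2'.
have e1 : 1 * u B + - u B * phi k B = 0 by rewrite phi_B; ring.
have e2 : 1 * v B + - u B * phi' k B = 0 by rewrite phi'_B vB; ring.
rewrite e1 e2 expr0n /= mul0r => /(_ _ erefl erefl x xB) H.
have {H} := H ltac:(by move=> y _; rewrite normr0).
rewrite !mul1r !mulNr => H.
have s1 := sqr_ge0 (u x - u B * phi k x); have s2 := sqr_ge0 (v x - u B * phi' k x).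
split; apply/eqP; rewrite -subr_eq0 -sqrf_eq0; apply/eqP; lra.
Qed.

(** The difference of the two solutions has zero data at B and solves the equation of k2 with source
    (W k2 - W k1) phi k1, of size |k2 - k1|. Restricting to |k2 - k1| <= 1 makes the energy estimate
    uniform. *)
Lemma shooting_lip k1 : exists2 C, 0 <= C & forall k2, `|k2 - k1| <= 1 ->
  forall x, 0 <= x <= B -> `|phi k2 x - phi k1 x| <= C * `|k2 - k1| /\
    `|phi' k2 x - phi' k1 x| <= C * `|k2 - k1|.
Proof.
have [w w0 Ww] := W_bound (`|k1| + 1).
have [P P0 phiP] := within_continuous_bounded (ltW B0) (proj1 (proj1 (phi_sol k1))).
pose D := (2 * `|k1| + 1) / h ^+ 2 * P.
have D0 : 0 <= D by rewrite mulr_ge0// divr_ge0 ?sqr_ge0// addr_ge0// mulr_ge0.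
pose G := (B - 0) * expR ((2 + w) * (B - 0)).
have G0 : 0 <= G by rewrite mulr_ge0 ?expR_ge0// subr0 ltW.
(* The energy estimate bounds squares; 1 + G replaces the square root of G, since G <= (1 + G)^2. *)
exists (D * (1 + G)); first by rewrite mulr_ge0// addr_ge0.
move=> k2 k21 x xB.
have k2k : `|k2| <= `|k1| + 1.
  have -> : k2 = k1 + (k2 - k1) by ring.
  by apply: (le_trans (ler_normD _ _)); rewrite lerD2l.
have [h1 h1'] := phi_sol k1; have [h2 h2'] := phi_sol k2.
have hd' : pw_deriv S 0 B (fun x => phi' k2 x - phi' k1 x)
   (fun x => W k2 x * (phi k2 x - phi k1 x) + (W k2 x - W k1 x) * phi k1 x).
  by apply: pw_deriv_eq (pw_derivB h2' h1') => y _ _; ring.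
have hX : forall y, 0 < y < B -> `|(W k2 y - W k1 y) * phi k1 y| <= D * `|k2 - k1|.
  move=> y /andP[y0 yB]; rewrite normrM /D mulrAC.
  apply: ler_pM => //; last by apply: phiP; rewrite !ltW.
  have -> : W k2 y - W k1 y = (k2 + k1) / h ^+ 2 * (k2 - k1).
    by rewrite /W; field; rewrite gt_eqF.
  rewrite normrM ler_wpM2r// normrM normfV [`|h ^+ 2|]ger0_norm ?sqr_ge0//.
  rewrite ler_wpM2r ?invr_ge0 ?sqr_ge0//; apply: (le_trans (ler_normD _ _)); lra.
have := ode_gronwall (ltW B0) w0 (fun y => Ww k2 y k2k) hX (pw_derivB h2 h1) hd'.
rewrite !phi_B !phi'_B !subrr => /(_ erefl erefl x xB); rewrite -/G => H.
clearbody D G.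
have bd z : z ^+ 2 <= (D * `|k2 - k1|) ^+ 2 * G -> `|z| <= D * (1 + G) * `|k2 - k1|.
  move=> hz; rewrite -(@ler_pXn2r _ 2)// ?nnegrE ?mulr_ge0 ?addr_ge0//.
  rewrite real_normK ?num_real//; apply: (le_trans hz).
  have -> : (D * (1 + G) * `|k2 - k1|) ^+ 2 = (D * `|k2 - k1|) ^+ 2 * (1 + G) ^+ 2.
    by ring.
  by apply: ler_wpM2l; [exact: sqr_ge0|nra].
have s1 := sqr_ge0 (phi k2 x - phi k1 x); have s2 := sqr_ge0 (phi' k2 x - phi' k1 x).
by split; apply: bd; lra.
Qed.

Definition shooting_mass k1 k2 := Rintegral mu `[0, B] (fun x => phi k1 x * phi k2 x).

Let phi_prod k1 k2 : pw_cont S 0 B (fun x => phi k1 x * phi k2 x).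
Proof.
by apply: pw_contM; apply: pw_cont_within (ltW B0) _; exact: (proj1 (proj1 (phi_sol _))).
Qed.

Lemma shooting_massE k1 k2 F : pw_deriv S 0 B F (fun x => phi k1 x * phi k2 x) ->
  shooting_mass k1 k2 = F B - F 0.
Proof.
move=> hF; have BB : 0 <= B <= B by rewrite lexx ltW.
rewrite (pw_deriv_integralE (ltW B0) (phi_prod k1 k2) hF BB) /shooting_mass.
by rewrite addrAC subrr add0r.
Qed.

(** The Wronskian of the two solutions vanishes at B, where both have derivative 0, and its
    derivative is (k2^2 - k1^2) / h^2 times their product. The identity is kept exact for k1 and k2
    apart, in place of a derivative in k. *)
Lemma shooting_wronskian k1 k2 :
  phi k2 0 * (h * phi' k1 0) - phi k1 0 * (h * phi' k2 0) =
  (k2 - k1) * ((k1 + k2) / h * shooting_mass k1 k2).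
Proof.
have h_neq0 : h != 0 by rewrite gt_eqF.
have [F F0 hF] := pw_primitive (ltW B0) (phi_prod k1 k2).
rewrite (shooting_massE hF) F0 subr0.
have h1 := wronskian_deriv (phi_sol k1) (phi_sol k2).
have h2 := pw_derivZ ((k2 ^+ 2 - k1 ^+ 2) / h ^+ 2) hF.
have {}h1 : pw_deriv S 0 B (fun x => phi k1 x * phi' k2 x - phi' k1 x * phi k2 x)
   (fun x => (k2 ^+ 2 - k1 ^+ 2) / h ^+ 2 * (phi k1 x * phi k2 x)).
  by apply: pw_deriv_eq h1 => x _ _; rewrite /W; field.
have := pw_deriv_unique h1 h2 (x := 0) (y := B).
rewrite !lexx !(ltW B0) F0 !phi_B !phi'_B => /(_ isT isT).
rewrite !mulr0 mul0r !subr0 => H.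
have -> : (k2 - k1) * ((k1 + k2) / h * F B) = h * ((k2 ^+ 2 - k1 ^+ 2) / h ^+ 2 * F B).
  by field.
rewrite -H; ring.
Qed.

Lemma shooting_continuous k : {for k, continuous (fun k => phi k 0)}.
Proof.
have [C _ HC] := shooting_lip k; apply: (@lipschitz_at_continuous _ _ C) => y y1.
by have [] := HC y y1 0 ltac:(by rewrite lexx ltW).
Qed.

Lemma shooting_deriv_continuous k : {for k, continuous (fun k => h * phi' k 0)}.
Proof.
apply: continuousM; first exact: cst_continuous.
have [C _ HC] := shooting_lip k; apply: (@lipschitz_at_continuous _ _ C) => y y1.
by have [] := HC y y1 0 ltac:(by rewrite lexx ltW).
Qed.

Lemma shooting_mass_continuous k : {for k, continuous (shooting_mass k)}.
Proof.
have [C C0 HC] := shooting_lip k.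
have [P P0 phiP] := within_continuous_bounded (ltW B0) (proj1 (proj1 (phi_sol k))).
apply: (@lipschitz_at_continuous _ _ (P * C * B)) => y y1.
have [F1 F10 hF1] := pw_primitive (ltW B0) (phi_prod k y).
have [F2 F20 hF2] := pw_primitive (ltW B0) (phi_prod k k).
rewrite (shooting_massE hF1) (shooting_massE hF2).
have := pw_deriv_lip (M := P * (C * `|y - k|)) (ltW B0) (pw_derivB hF1 hF2) _.
rewrite F10 F20 !subr0 => H; have {H} : `|F1 B - F2 B| <= P * (C * `|y - k|) * B.
  apply: H => x /andP[x0 xB]; rewrite -mulrBr normrM.
  have xI : 0 <= x <= B by rewrite !ltW.
  by apply: ler_pM => //; [exact: phiP|exact: (proj1 (HC y y1 x xI))].
by congr (_ <= _); ring.
Qed.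

End Shooting.

(** * Consequences of piecewise continuity of V *)

Section Potential.
Variable R : realType.
Implicit Types (S : seq R) (V : R -> R).

Lemma piecewise_continuous_seq (B : R) V : piecewise_continuous B V ->
  (forall x, x < 0 -> V x = 0) -> 0 < B ->
  exists S : seq R, forall x, x < B -> x \notin S -> {for x, continuous V}.
Proof.
move=> [fV _ _] V0 B0; have /finite_seqP [S SE] := fV 0 B0.
exists (0 :: S) => x xB; rewrite inE negb_or => /andP[x_neq0 xS].
have [x0|x0] := ltP x 0.
  rewrite /prop_for /continuous_at V0//.
  apply: cvg_near_cst; near=> y; apply: V0; near: y; exact: lt_nbhsl.
apply: contrapT => nV; move: xS; apply/negP/negPn.
have : [set` S] x by rewrite -SE /= x0 xB.
by [].
Unshelve. all: by end_near. Qed.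

(** The one-sided limits and the value at the point itself bound V near each point, and compactness
    of [a, B] makes the bound uniform. *)
Lemma piecewise_continuous_bounded (B : R) V : piecewise_continuous B V ->
  forall a, a < B -> exists M, forall x, a <= x <= B -> `|V x| <= M.
Proof.
move=> [_ lV rV] a aB.
have := @segment_compact R a B.
move/compact_near_coveringP/near_covering_withinP.
move=> /(_ R +oo%R (fun M x => x <= B -> `|V x| <= M) _).
have loc x : a <= x <= B -> exists M, \forall y \near x, y <= B -> `|V y| <= M.
  move=> /andP[ax xB].
  have /cvg_ex[/= l /cvgrPdist_lt/(_ 1 ltr01)] := lV x xB.
  rewrite near_withinE => nl.
  (* At x = B the requirement is void and r = 0 is a placeholder. *)
  have [r nr] : exists r, \forall y \near x, x < y -> y <= B -> `|r - V y| < 1.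
    move: xB; rewrite le_eqVlt => /predU1P[->|xB].
      by exists 0; near=> y => By; rewrite leNgt By.
    have /cvg_ex[/= r /cvgrPdist_lt/(_ 1 ltr01)] := rV x xB.
    rewrite near_withinE => nr; exists r; near=> y => xy _.
    by move: xy; near: y.
  exists (`|l| + `|r| + `|V x| + 1); near=> y => yB.
  have [yx|xy|->] := ltgtP y x.
  - have : `|l - V y| < 1 by move: yx; near: y.
    have := ler_normB l (l - V y); rewrite subKr.
    have := normr_ge0 r; have := normr_ge0 (V x); lra.
  - have : `|r - V y| < 1 by move: xy yB; near: y.
    have := ler_normB r (r - V y); rewrite subKr.
    have := normr_ge0 l; have := normr_ge0 (V x); lra.
  - have := normr_ge0 r; have := normr_ge0 l; lra.
move=> H; have {H} : \forall M \near +oo%R, `[a, B]%classic `<=` (fun x => x <= B -> `|V x| <= M).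
  apply: H => x; rewrite /= in_itv /= => /loc[M nM].
  exists ([set y | y <= B -> `|V y| <= M], [set N | M <= N]).
    by split => //=; exact: nbhs_pinfty_ge (num_real M).
  by move=> [y N] /= [h1 h2] _ yB; exact: le_trans (h1 yB) h2.
move=> [M [_ /(_ (M + 1) ltac:(by rewrite ltrDl))]] H.
exists (M + 1) => x /[dup] xI /andP[_ xB]; exact: H.
Unshelve. all: by end_near. Qed.

End Potential.

(** * Between H^2 solutions almost everywhere and classical solutions off the jumps *)

Section Conversions.
Local Open Scope complex_scope.
Variable R : realType.
Implicit Types (S : seq R) (W : R -> R) (u v : R -> R[i]).
Local Notation mu := (@lebesgue_measure R).

Lemma ae_mono (P Q : R -> Prop) : (forall x, P x -> Q x) ->
  {ae mu, forall x, P x} -> {ae mu, forall x, Q x}.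
Proof. by apply: filterS; exact: (ae_filter_ringOfSetsType mu). Qed.

Lemma within_continuous_primitive (a b : R) (p p1 : R -> R) : a <= b ->
  mu.-integrable `[a, b] (EFin \o p1) ->
  (forall x, a <= x <= b -> p x = p a + Rintegral mu `[a, x] p1) ->
  {within `[a, b], continuous p}.
Proof.
move=> ab ip1 pE.
apply: (@subspace_eq_continuous _ _ _ (fun x => p a + Rintegral mu `[a, x] p1)).
  by move=> x; rewrite inE /= in_itv /= => /pE.
have c1 := proj1 (pw_deriv_cst [::] a b (p a)).
have c2 := parameterized_integral_continuous ab ip1.
by move=> x; exact: continuousD (c1 x) (c2 x).
Qed.

(** Under the integral, p2 may be replaced by W p, to which it is equal almost everywhere; as W p is
    continuous off [S], the fundamental theorem of calculus then gives classical derivatives. *)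
Lemma ode_sol_of_integrals S (a b : R) W (p p1 p2 : R -> R) : a <= b ->
  pw_cont S a b W ->
  mu.-integrable `[a, b] (EFin \o p1) -> mu.-integrable `[a, b] (EFin \o p2) ->
  (forall x, a <= x <= b -> p x = p a + Rintegral mu `[a, x] p1) ->
  (forall x, a <= x <= b -> p1 x = p1 a + Rintegral mu `[a, x] p2) ->
  {ae mu, forall x, a <= x <= b -> p2 x = W x * p x} ->
  ode_sol S a b W p p1.
Proof.
move=> ab hW ip1 ip2 pE p1E p2E.
have cp := within_continuous_primitive ab ip1 pE.
have cp1 := within_continuous_primitive ab ip2 p1E.
have hWp : pw_cont S a b (fun x => W x * p x).
  exact: pw_contM hW (pw_cont_within S ab cp).
split.
  have := pw_deriv_integral (S := S) ab ip1 (proj2 (pw_cont_within S ab cp1)).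
  move=> /(pw_derivD (pw_deriv_cst S a b (p a))) h.
  have := pw_deriv_ext (fun x xI => esym (pE x xI)) h.
  by apply: pw_deriv_eq => x _ _; rewrite add0r.
have := pw_deriv_integral ab (pw_cont_integrable hWp) (proj2 hWp).
move=> /(pw_derivD (pw_deriv_cst S a b (p1 a))) h.
suff e x : a <= x <= b -> p1 a + Rintegral mu `[a, x] (fun x => W x * p x) = p1 x.
  by have := pw_deriv_ext e h; apply: pw_deriv_eq => x _ _; rewrite add0r.
move=> /[dup] xI /andP[ax xb]; rewrite [RHS]p1E//; congr (_ + _); congr fine.
have sub : `[a, x]%classic `<=` `[a, b]%classic.
  by move=> y; rewrite /= !in_itv /= => /andP[-> yx]; exact: le_trans yx xb.
apply: ae_eq_integral => //.
- by apply: measurable_funS sub (measurable_int _ (pw_cont_integrable hWp)).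
- by apply: measurable_funS sub (measurable_int _ ip2).
- move: p2E; apply: ae_mono => y H /=; rewrite in_itv /= => /andP[ay yx].
  by rewrite H// ay (le_trans yx xb).
Qed.

(** The spectral parameter - k^2 is real, so real and imaginary parts solve the same real equation
    separately. *)
Lemma Re_H2_ode_sol S (a b h k : R) V D u u1 u2 : a < b -> h != 0 ->
  pw_cont S a b (fun x => (V x + k ^+ 2) / h ^+ 2) ->
  H2_on a b u u1 u2 -> (forall x, a <= x <= b -> D x) ->
  schrodinger_eq V h (- (k ^+ 2)%:C) D u u2 ->
  ode_sol S a b (fun x => (V x + k ^+ 2) / h ^+ 2)
    (fun x => complex.Re (u x)) (fun x => complex.Re (u1 x)) /\
  ode_sol S a b (fun x => (V x + k ^+ 2) / h ^+ 2)
    (fun x => complex.Im (u x)) (fun x => complex.Im (u1 x)).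
Proof.
move=> ab h_neq0 hW [[[iR1 iI1] uE] [[iR2 iI2] u1E] _] hD eqn.
have {eqn} : {ae mu, forall x, a <= x <= b ->
    complex.Re (u2 x) = (V x + k ^+ 2) / h ^+ 2 * complex.Re (u x) /\
    complex.Im (u2 x) = (V x + k ^+ 2) / h ^+ 2 * complex.Im (u x)}.
  move: eqn; apply: ae_mono => x H xI; have {H} := H (hD x xI).
  case: (u x) (u2 x) => r i [r2 i2]; move/eqP; rewrite eq_complex /= => /andP[].
  simpc => /eqP E1 /eqP E2; split.
    have -> : r2 = (h ^+ 2 * r2) / h ^+ 2 by field.
    rewrite [RHS]mulrAC; congr (_ / _); lra.
  have -> : i2 = (h ^+ 2 * i2) / h ^+ 2 by field.
  rewrite [RHS]mulrAC; congr (_ / _); lra.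
move=> eqn; split.
  apply: (@ode_sol_of_integrals _ _ _ _ _ _ (fun x => complex.Re (u2 x))) => //.
  - exact: ltW.
  - by move=> x /uE ->; case: (u a).
  - by move=> x /u1E ->; case: (u1 a).
  - by move: eqn; apply: ae_mono => x H /H[].
apply: (@ode_sol_of_integrals _ _ _ _ _ _ (fun x => complex.Im (u2 x))) => //.
- exact: ltW.
- by move=> x /uE ->; case: (u a).
- by move=> x /u1E ->; case: (u1 a).
- by move: eqn; apply: ae_mono => x H /H[].
Qed.

Lemma AC_of_pw_deriv S (a b : R) (p p1 : R -> R) : a <= b ->
  pw_cont S a b p1 -> pw_deriv S a b p p1 ->
  AC_with_derivative a b (fun x => (p x)%:C) (fun x => (p1 x)%:C).
Proof.
move=> ab c1 hp; split.
  split; first exact: pw_cont_integrable c1.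
  by rewrite /=; exact: integrable0.
move=> x xI; rewrite (pw_deriv_integralE ab c1 hp xI) /cintegral /=.
have -> : Rintegral mu `[a, x] (fun=> 0) = 0 :> R by rewrite Rintegral_cst// mul0r.
by apply/eqP; rewrite eq_complex /= addr0 !eqxx.
Qed.

Lemma H2_of_ode_sol S (a b : R) W (p p1 : R -> R) : a <= b ->
  pw_cont S a b W -> ode_sol S a b W p p1 ->
  H2_on a b (fun x => (p x)%:C) (fun x => (p1 x)%:C) (fun x => (W x * p x)%:C).
Proof.
move=> ab hW [hp hp1].
have c1 := pw_cont_within S ab (proj1 hp1).
have c2 := pw_contM hW (pw_cont_within S ab (proj1 hp)).
split; [exact: AC_of_pw_deriv hp|exact: AC_of_pw_deriv hp1|split].
- exact: measurable_fun_pw_cont (proj2 c2).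
- exact: measurable_cst.
- have -> : (fun x => ((complex.Re (W x * p x)%:C) ^+ 2 + (complex.Im (W x * p x)%:C) ^+ 2)%:E)
      = EFin \o (fun x => (W x * p x) * (W x * p x)).
    by apply/funext => x /=; rewrite expr0n /= addr0 expr2.
  exact: pw_cont_integrable (pw_contM c2 c2).
Qed.

Lemma schrodinger_eq_ode V (h k : R) D (p : R -> R) : h != 0 ->
  schrodinger_eq V h (- (k ^+ 2)%:C) D (fun x => (p x)%:C)
    (fun x => ((V x + k ^+ 2) / h ^+ 2 * p x)%:C).
Proof.
move=> h_neq0; apply: aeW => x _; apply/eqP; rewrite eq_complex /=.
by simpc; apply/andP; split=> //; apply/eqP; field.
Qed.

(** Points outside the finite set [S] accumulate at b. This transfers identities known for x < 0 to
    the boundary point 0. *)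
Lemma within_continuous_zero S (a b : R) (g : R -> R) : a < b ->
  {within `[a, b], continuous g} ->
  (forall x, a < x < b -> x \notin S -> g x = 0) -> g b = 0.
Proof.
move=> ab cg g0; apply/eqP/negPn/negP => gb.
have bI : `[a, b]%classic b by rewrite /= in_itv /= lexx ltW.
move/subspace_continuousP: cg => /(_ b bI)/cvgrPdist_lt/(_ `|g b|).
rewrite normr_gt0 gb => /(_ isT); rewrite near_withinE => /nbhs_ballP[d /= d0 hd].
have ab' : Num.max a (b - d) < b by rewrite gt_max ab; lra.
have [a' [b' [aa ab'' bb xS]]] := subinterval_avoiding S ab'.
move: aa; rewrite ge_max => /andP[aa da].
pose m := (a' + b') / 2.
have am : a' < m by rewrite /m; lra.
have mb : m < b' by rewrite /m; lra.
have : `|g b - g m| < `|g b|.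
  apply: hd; first by rewrite /ball /= ger0_norm; lra.
  by rewrite /= in_itv /=; apply/andP; split; lra.
have -> : g m = 0.
  by apply: g0; [apply/andP; split; lra|apply: xS; rewrite am].
by rewrite subr0 ltxx.
Qed.

Lemma pw_deriv_glue S (a c b : R) (f df : R -> R) : a < c -> c < b ->
  pw_deriv S a c f df -> pw_deriv S c b f df -> pw_deriv (c :: S) a b f df.
Proof.
move=> ac cb [c1 d1] [c2 d2]; split.
  have -> : `[a, b]%classic = `[a, c] `|` `[c, b].
    apply/seteqP; split=> x /=; rewrite !in_itv /=.
      by move=> /andP[-> ->]; case: (leP x c) => h; [left|right; rewrite ltW].
    case=> /andP[h1 h2]; first by rewrite h1 (le_trans h2 (ltW cb)).
    by rewrite h2 (le_trans (ltW ac) h1).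
  by apply: withinU_continuous => //; exact: interval_closed.
move=> x /andP[ax xb]; rewrite inE negb_or => /andP[xc xS].
have [xc'|cx|e] := ltgtP x c; last by rewrite e eqxx in xc.
  by apply: d1 => //; rewrite ax.
by apply: d2 => //; rewrite cx.
Qed.

End Conversions.

(** * Spectral notions as conditions on the shooting solution at 0 *)

Section Characterization.
Local Open Scope complex_scope.
Variable R : realType.
Variables (S : seq R) (B h : R) (V : R -> R).
Hypotheses (B0 : 0 < B) (h0 : 0 < h).
Hypothesis V_cont : forall a, a < B -> pw_cont S a B V.
Hypothesis V_supp : forall x, x < 0 -> V x = 0.
Variables phi phi' : R -> R -> R.
Hypothesis phi_sol : forall k,
  ode_sol S 0 B (fun x => (V x + k ^+ 2) / h ^+ 2) (phi k) (phi' k).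
Hypothesis phi_B : forall k, phi k B = 1.
Hypothesis phi'_B : forall k, phi' k B = 0.

Let h_neq0 : h != 0. Proof. by rewrite gt_eqF. Qed.
Let V0 := V_cont B0.

Lemma neumann_eigenvalueP k :
  neumann_eigenvalue V B h k <-> 0 < k /\ phi' k 0 = 0.
Proof.
split=> [[k0 [u [u1 [u2 [uH2 [x xB ux] eqn u1B u10]]]]]|[k0 phi'0]]; split=> //.
  have hD y : 0 <= y <= B -> `[0, B]%classic y by rewrite /= in_itv.
  have [hR hI] := Re_H2_ode_sol B0 h_neq0 (pw_cont_potential k h0 V0) uH2 hD eqn.
  have UR := shooting_unique B0 h0 V0 phi_sol phi_B phi'_B hR (congr1 (@complex.Re R) u1B).
  have UI := shooting_unique B0 h0 V0 phi_sol phi_B phi'_B hI (congr1 (@complex.Im R) u1B).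
  have B00 : (0 : R) <= 0 <= B by rewrite lexx ltW.
  have [_ R0] := UR 0 B00; have [_ I0] := UI 0 B00.
  rewrite /= u10 /= in R0 I0.
  apply/eqP/negPn/negP => phi'0; move: ux; rewrite eq_complex /= (proj1 (UR x xB)) (proj1 (UI x xB)).
  have /eqP := esym R0; rewrite mulf_eq0 (negbTE phi'0) orbF => /eqP ->.
  have /eqP := esym I0; rewrite mulf_eq0 (negbTE phi'0) orbF => /eqP ->.
  by rewrite !mul0r eqxx.
exists (fun x => (phi k x)%:C), (fun x => (phi' k x)%:C),
  (fun x => ((V x + k ^+ 2) / h ^+ 2 * phi k x)%:C); split.
- exact: H2_of_ode_sol (ltW B0) (pw_cont_potential k h0 V0) (phi_sol k).
- by exists B; [rewrite lexx ltW|rewrite phi_B oner_eq0].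
- exact: schrodinger_eq_ode.
- by rewrite phi'_B.
- by rewrite phi'0.
Qed.

Lemma cexp_outgoing kappa x :
  cexp (- 'i%C * ('i%C * kappa%:C) * x%:C / h%:C) = (expR (kappa / h * x))%:C.
Proof.
have -> : - 'i%C * ('i%C * kappa%:C) * x%:C / h%:C = (kappa / h * x)%:C.
  by rewrite mulrA mulNr -expr2 sqr_i opprK mul1r !rmorphM /= fmorphV mulrAC.
by rewrite /cexp /= cos0 sin0 mulr1 mulr0.
Qed.

Lemma outgoing_sqr (kappa : R) : ('i%C * kappa%:C) ^+ 2 = - (kappa ^+ 2)%:C.
Proof. by rewrite exprMn sqr_i mulN1r rmorphXn. Qed.

(** The exponential form is known only for x < 0; continuity of p and of its derivative v carries
    value and slope to 0. *)
Lemma outgoing_boundary (p v : R -> R) (alpha kappa : R) :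
  pw_deriv S (-1) 0 p v -> {within `[-1, 0], continuous v} ->
  (forall x, x < 0 -> p x = alpha * expR (kappa / h * x)) ->
  p 0 = alpha /\ h * v 0 = kappa * alpha.
Proof.
move=> hp cv pE.
have E := pw_derivZ alpha (pw_deriv_exp S (-1) 0 (kappa / h)).
have E' := pw_derivZ alpha (pw_derivZ (kappa / h) (pw_deriv_exp S (-1) 0 (kappa / h))).
have [cf df] := pw_derivB hp E.
have lt10 : -1 < 0 :> R by lra.
split.
  have := within_continuous_zero (S := S) lt10 cf.
  rewrite mulr0 expR0 mulr1 => H; apply/eqP; rewrite -subr_eq0; apply/eqP; apply: H.
  by move=> x /andP[_ x0] _; rewrite pE// subrr.
have cg : {within `[-1, 0], continuous (fun x => v x - alpha * (kappa / h * expR (kappa / h * x)))}.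
  by move=> x; exact: continuousD (cv x) (continuousN (proj1 E' x)).
have := within_continuous_zero (S := S) lt10 cg.
rewrite mulr0 expR0 mulr1 => H.
have {}H : v 0 - alpha * (kappa / h) = 0.
  apply: H => x xI xS; have /andP[_ x0] := xI.
  have d1 := df x xI xS.
  have d2 : is_derive x 1 (fun y => p y - alpha * expR (kappa / h * y)) 0.
    apply: near_eq_is_derive (is_derive_cst 0 x 1).
    by near=> y; rewrite pE ?subrr//; near: y; exact: lt_nbhsl.
  by rewrite -(@derive_val _ _ _ _ _ _ _ d1) (@derive_val _ _ _ _ _ _ _ d2).
have -> : v 0 = alpha * (kappa / h) by lra.
by field.
Unshelve. all: by end_near. Qed.

(** For x < 0 the potential vanishes and kappa^2 = k^2, so the exponential solves the same equation;
    the slope condition says exactly that the derivatives match at 0, which joins the exceptional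
    points. *)
Lemma outgoing_extension k kappa : kappa ^+ 2 = k ^+ 2 ->
  h * phi' k 0 = kappa * phi k 0 -> forall a, a < B ->
  ode_sol (0 :: S) a B (fun x => (V x + k ^+ 2) / h ^+ 2)
    (fun x => if x < 0 then phi k 0 * expR (kappa / h * x) else phi k x)
    (fun x => if x < 0 then phi k 0 * (kappa / h * expR (kappa / h * x)) else phi' k x).
Proof.
move=> kk bc a aB.
wlog a0 : a aB / a < 0.
  move=> H; have [a0|a0] := ltP a 0; first exact: H.
  have [||h1 h2] := H (-1); [lra|lra|].
  by split; [apply: pw_deriv_sub _ (lexx B) h1|apply: pw_deriv_sub _ (lexx B) h2]; lra.
have [hp hp'] := phi_sol k.
have E := pw_derivZ (phi k 0) (pw_deriv_exp S a 0 (kappa / h)).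
have E' := pw_derivZ (phi k 0) (pw_derivZ (kappa / h) (pw_deriv_exp S a 0 (kappa / h))).
split; apply: pw_deriv_glue => //.
- apply: (@pw_deriv_ext _ _ _ _ (fun x => phi k 0 * expR (kappa / h * x))).
    move=> x /andP[_]; rewrite le_eqVlt => /predU1P[->|-> //].
    by rewrite ltxx mulr0 expR0 mulr1.
  by apply: pw_deriv_eq E => x /andP[_ ->].
- apply: (@pw_deriv_ext _ _ _ _ (phi k)).
    by move=> x /andP[x0 _]; rewrite ltNge x0.
  by apply: pw_deriv_eq hp => x /andP[x0 _] _; rewrite ltNge (ltW x0).
- apply: (@pw_deriv_ext _ _ _ _ (fun x => phi k 0 * (kappa / h * expR (kappa / h * x)))).
    move=> x /andP[_]; rewrite le_eqVlt => /predU1P[->|-> //].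
    rewrite ltxx mulr0 expR0 mulr1.
    have -> : phi' k 0 = h * phi' k 0 / h by field.
    by rewrite bc; field.
  apply: pw_deriv_eq E' => x /andP[_ x0] _; rewrite x0 V_supp// add0r -kk.
  by field.
- apply: (@pw_deriv_ext _ _ _ _ (phi' k)).
    by move=> x /andP[x0 _]; rewrite ltNge x0.
  by apply: pw_deriv_eq hp' => x /andP[x0 _] _; rewrite ltNge (ltW x0).
Qed.

(** Taking kappa = k or kappa = - k covers bound and antibound states at once. On [0, B] both parts
    of a resonant state are multiples of phi; if the slope condition failed, both multiples would
    vanish, and the exponential on x < 0 with them. *)
Lemma resonanceP k kappa : kappa ^+ 2 = k ^+ 2 ->
  is_resonance V B h ('i%C * kappa%:C) <-> h * phi' k 0 = kappa * phi k 0.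
Proof.
move=> kk; rewrite /is_resonance outgoing_sqr kk; split.
  move=> [u [u1 [u2 [uH2 [x xB ux] eqn u1B [alpha uE]]]]].
  have lt1B : (- 1 : R) < B by exact: lt_trans (ltrN10 R) B0.
  have hD (y : R) : - 1 <= y <= B -> `]-oo, B]%classic y by rewrite /= in_itv => /andP[].
  have [hR hI] := Re_H2_ode_sol lt1B h_neq0 (pw_cont_potential k h0 (V_cont lt1B)) (uH2 _ lt1B) hD eqn.
  have le10 : -1 <= 0 :> R by lra.
  have restr p v : ode_sol S (-1) B (fun x => (V x + k ^+ 2) / h ^+ 2) p v ->
      ode_sol S 0 B (fun x => (V x + k ^+ 2) / h ^+ 2) p v.
    by move=> [h1 h2]; split; [exact: pw_deriv_sub h1|exact: pw_deriv_sub h2].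
  have UR := shooting_unique B0 h0 V0 phi_sol phi_B phi'_B (restr _ _ hR) (congr1 (@complex.Re R) u1B).
  have UI := shooting_unique B0 h0 V0 phi_sol phi_B phi'_B (restr _ _ hI) (congr1 (@complex.Im R) u1B).
  have B00 : (0 : R) <= 0 <= B by rewrite lexx ltW.
  have neg p v : ode_sol S (-1) B (fun x => (V x + k ^+ 2) / h ^+ 2) p v ->
      pw_deriv S (-1) 0 p v /\ {within `[-1, 0], continuous v}.
    move=> [h1 h2]; split; first exact: pw_deriv_sub (lexx _) (ltW B0) h1.
    exact: (proj1 (pw_deriv_sub (lexx _) (ltW B0) h2)).
  have uE' y : y < 0 -> u y = (complex.Re alpha * expR (kappa / h * y)) +i*
      (complex.Im alpha * expR (kappa / h * y)).
    move=> /uE ->; rewrite cexp_outgoing; case: (alpha) => r i /=.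
    by apply/eqP; rewrite eq_complex /= !mulr0 subr0 add0r !eqxx.
  have [R1 R2] := outgoing_boundary (proj1 (neg _ _ hR)) (proj2 (neg _ _ hR))
    (fun x x0 => congr1 (@complex.Re R) (uE' x x0)).
  have [I1 I2] := outgoing_boundary (proj1 (neg _ _ hI)) (proj2 (neg _ _ hI))
    (fun x x0 => congr1 (@complex.Im R) (uE' x x0)).
  have [R3 R4] := UR 0 B00; have [I3 I4] := UI 0 B00.
  apply/eqP/negPn/negP => nbc; move: ux.
  have uB p v : p = v * phi k 0 -> h * (v * phi' k 0) = kappa * p -> v = 0.
    move=> -> /eqP; rewrite mulrCA [kappa * _]mulrCA -subr_eq0 -mulrBr mulf_eq0.
    by rewrite [_ - _ == 0]subr_eq0 (negbTE nbc) orbF => /eqP.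
  have RB : complex.Re (u B) = 0 by apply: (uB _ _ R3); rewrite -R4 R2 R1.
  have IB : complex.Im (u B) = 0 by apply: (uB _ _ I3); rewrite -I4 I2 I1.
  have [x0|x0] := ltP x 0.
    rewrite uE' // eq_complex /=.
    by rewrite -R1 -I1 R3 I3 RB IB !mul0r eqxx.
  have xI : 0 <= x <= B by rewrite x0.
  by rewrite eq_complex /= (proj1 (UR x xI)) (proj1 (UI x xI)) RB IB !mul0r eqxx.
move=> bc; have sol := outgoing_extension kk bc.
pose S0 := 0 :: S.
exists (fun x => (if x < 0 then phi k 0 * expR (kappa / h * x) else phi k x)%:C),
 (fun x => (if x < 0 then phi k 0 * (kappa / h * expR (kappa / h * x)) else phi' k x)%:C),
 (fun x => ((V x + k ^+ 2) / h ^+ 2 * (if x < 0 then phi k 0 * expR (kappa / h * x) else phi k x))%:C).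
have B0' : (B < 0) = false by rewrite ltNge ltW.
split.
- move=> a aB; apply: H2_of_ode_sol (ltW aB) _ (sol a aB).
  apply: pw_cont_potential => //; have [bV cV] := V_cont aB; split=> // x xI.
  by rewrite inE negb_or => /andP[_]; exact: cV.
- by exists B; rewrite ?lexx// B0' phi_B oner_eq0.
- exact: schrodinger_eq_ode.
- by rewrite B0' phi'_B.
- exists (phi k 0)%:C => x x0; rewrite cexp_outgoing x0.
  by rewrite -rmorphM.
Qed.

End Characterization.

(* The crossing is found to the right of [k] if m' = m - 1, and to its left if
   m' = m + 1, by applying [cone_crossing] to t |-> a (- t), - b (- t). *)
Lemma crossing_nearby (R : realType) (a b : R -> R) (Q : R -> R -> R)
    (k e M m m' : R) : 0 < e -> e <= k ->
  (forall t, {for t, continuous a}) -> (forall t, {for t, continuous b}) ->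
  (forall t, {for t, continuous (Q t)}) ->
  (forall t1 t2, a t2 * b t1 - a t1 * b t2 = (t2 - t1) * Q t1 t2) ->
  (forall t, `|k - t| <= e -> `|b t| <= (k + 3 * e) * `|a t| -> M * a t ^+ 2 <= Q t t) ->
  k <= (M - 1) * e -> b k = m * k * a k ->
  m' = m - 1 /\ -1 <= m' <= 0 \/ m' = m + 1 /\ 0 <= m' <= 1 ->
  exists2 t, `|k - t| <= e & b t = m' * t * a t.
Proof.
move=> e0 ek ca cb cQ HQ HM kM bk mm.
have k0 : 0 < k by exact: lt_le_trans ek.
case: mm => -[mE /andP[m1 m2]].
  (* The gap m k - m' k equals k. As - (k + e) <= m' t <= 0, the choice K = k + 3 e meets the cone
     condition on both sides. *)
  have [|||||t /andP[t1 t2] bt] := @cone_crossing R a b Q k e (k + 3 * e) M (m * k) m' e0 ca cb cQ HQ.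
  - move=> t /andP[t1 t2]; apply: HM; rewrite distrC ger0_norm; lra.
  - exact: bk.
  - exact: m1.
  - by rewrite mE; apply/andP; split; lra.
  - move=> t /andP[t1 t2]; apply/andP; split; nra.
  - by exists t => //; rewrite distrC ger0_norm; lra.
have cN (t : R) : {for t, continuous (fun t : R => - t)}.
  by apply: continuousN; exact: cvg_id.
have [|||||||||t /andP[t1 t2] bt] := @cone_crossing R (fun t => a (- t)) (fun t => - b (- t))
   (fun t1 t2 => Q (- t1) (- t2)) (- k) e (k + 3 * e) M (- m * k) m' e0.
- by move=> t; apply: continuous_comp; [exact: cN|exact: ca].
- by move=> t; apply: continuousN; apply: continuous_comp; [exact: cN|exact: cb].
- by move=> t; apply: continuous_comp; [exact: cN|exact: cQ].
- move=> t1 t2; have := HQ (- t1) (- t2); lra.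
- move=> t /andP[t1 t2]; rewrite normrN; apply: HM; rewrite opprK ger0_norm; lra.
- by rewrite !opprK bk; ring.
- lra.
- by rewrite mE; apply/andP; split; lra.
- move=> t /andP[t1 t2]; apply/andP; split; nra.
- exists (- t); first by rewrite opprK ger0_norm; lra.
  lra.
Qed.

(** * Choice of the constants and conclusion *)

Theorem theorem1 (R : realType) (B : R) (V : R -> R) (ck Ck : R)
    (B_gt0 : 0 < B)
    (V_pc : piecewise_continuous B V)
    (V_supp : forall x : R, x < 0 -> V x = 0)
    (V_bump : exists2 A : R, 0 < A <= B & forall x : R, 0 < x <= A -> 0 < V x)
    (ck_gt0 : 0 < ck) (ck_lt_Ck : ck < Ck) :
  exists C delta h0 : R, [/\ 0 < C, 0 < delta, 0 < h0 &
    forall h k : R, 0 < h < h0 -> ck <= k <= Ck ->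
      (neumann_eigenvalue V B h k ->
        (exists2 kp, bound_state V B h kp &
           `|k - kp| <= C * expR (- (delta / h))) /\
        (exists2 km, antibound_state V B h km &
           `|k - km| <= C * expR (- (delta / h)))) /\
      (bound_state V B h k \/ antibound_state V B h k ->
        exists2 k0, neumann_eigenvalue V B h k0 &
          `|k - k0| <= C * expR (- (delta / h)))].
Proof.
have [S cV] := piecewise_continuous_seq V_pc V_supp B_gt0.
have V_cont a : a < B -> pw_cont S a B V.
  move=> aB; split; first exact: piecewise_continuous_bounded aB.
  by move=> x /andP[_ xB]; exact: cV.
have [A /[dup] A_B /andP[A0 AB] VA] := V_bump.
(* Crossing parameters lie within e <= ck / 2 of k, so the tunnelling estimate is needed on the
   larger range [ck / 2, 2 Ck]. *)
have kl0 : 0 < ck / 2 by rewrite divr_gt0.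
have klr : 0 < ck / 2 <= 2 * Ck by rewrite kl0; lra.
have [c1 [c2 [sigma [h1 [c1_gt0 c2_gt0 sigma0 h1_gt0 tunnel]]]]] :
    exists c1 c2 sigma h0, [/\ 0 < c1, 0 < c2, 0 < sigma, 0 < h0 & _] :=
  @tunnelling R S A B (ck / 2) (2 * Ck) V A_B klr
   (fun x xI => cV x (lt_le_trans (proj2 (andP xI)) AB))
   (fun x xI => VA x (introT andP (conj (proj1 (andP xI)) (ltW (proj2 (andP xI)))))).
have Ck0 : 0 < Ck by lra.
(* With M = ck c1 e^(sigma/h) and e = C e^(-sigma/(2h)), this value gives M e / 2 = Ck
   e^(sigma/(2h)), hence k <= (M - 1) e once M >= 2. *)
pose C := Ck / (ck / 2 * c1).
have C0 : 0 < C by rewrite divr_gt0 ?mulr_gt0.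
have CE : C * (ck / 2 * c1) = Ck by rewrite divfK// gt_eqF ?mulr_gt0.
clearbody C.
(* The last three bounds yield, in this order and through x <= e^x, M >= 2, 4 e <=
   [c2 * expR (- (sigma / 4 / h))] and e <= ck / 2. *)
pose h2 := Num.min 1 (Num.min (sigma * (ck / 2) * c1)
  (Num.min (sigma * c2 / (16 * C)) (sigma * ck / (4 * C)))).
exists C, (sigma / 2), (Num.min h1 h2); split => //.
- by rewrite divr_gt0.
- rewrite /h2 !lt_min h1_gt0 ltr01 /=; apply/and3P; split.
  + exact: mulr_gt0 (mulr_gt0 sigma0 kl0) c1_gt0.
  + by apply: divr_gt0; apply: mulr_gt0.
  + by apply: divr_gt0; apply: mulr_gt0.
move=> h k /andP[h0]; rewrite /h2 !lt_min => /and5P[hh1 h_1 hM heta he] /andP[ckk kCk].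
have h_neq0 : h != 0 by rewrite gt_eqF.
have expS x : 0 <= x -> x <= expR x by move=> _; have := expR_ge1Dx x; lra.
set e := C * _.
have e0 : 0 < e by rewrite mulr_gt0 ?expR_gt0.
have k0 : 0 < k by lra.
have e_ck : e <= ck / 2.
  rewrite /e expRN ler_pdivrMr ?expR_gt0//.
  have : C <= ck / 2 * (sigma / 2 / h).
    rewrite mulrA ler_pdivlMr//; move: he; rewrite ltr_pdivlMr ?mulr_gt0// => he; lra.
  move/le_trans; apply; rewrite ler_pM2l//; apply: expS.
  by rewrite ltW// !divr_gt0.
have e_eta : 4 * e <= c2 * expR (- (sigma / 4 / h)).
  have -> : e = C * (expR (- (sigma / 4 / h)) * expR (- (sigma / 4 / h))).
    by rewrite /e -expRD; congr (_ * expR _); field.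
  rewrite !mulrA ler_pM2r ?expR_gt0// expRN ler_pdivrMr ?expR_gt0//.
  have : 4 * C <= c2 * (sigma / 4 / h).
    rewrite mulrA ler_pdivlMr//; move: heta; rewrite ltr_pdivlMr ?mulr_gt0// => heta; lra.
  move/le_trans; apply; rewrite ler_pM2l//; apply: expS.
  by rewrite ltW// !divr_gt0.
pose M := ck * c1 * expR (sigma / h).
have M2 : 2 <= M.
  have : 2 <= ck * c1 * (sigma / h) by rewrite mulrA ler_pdivlMr//; lra.
  move/le_trans; apply; rewrite ler_pM2l ?mulr_gt0//; apply: expS.
  by rewrite ltW// divr_gt0.
have kM : k <= (M - 1) * e.
  apply: (le_trans kCk); apply: (@le_trans _ _ (M / 2 * e)); last by rewrite ler_pM2r//; lra.
  have -> : M / 2 * e = Ck * expR (sigma / 2 / h).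
    rewrite /M /e -CE.
    have -> : expR (sigma / h) = expR (sigma / 2 / h) * expR (sigma / 2 / h).
      by rewrite -expRD; congr expR; field.
    by rewrite expRN; field; rewrite gt_eqF ?expR_gt0.
  rewrite -[leLHS]mulr1 ler_pM2l// -[leLHS]expR0 ler_expR.
  by rewrite ltW// !divr_gt0.
have V0 := V_cont 0 B_gt0.
have [phi /choice [phi' hphi]] : exists phi : R -> R -> R, forall k, exists v,
    [/\ ode_sol S 0 B (fun x => (V x + k ^+ 2) / h ^+ 2) (phi k) v, phi k B = 1 & v B = 0].
  have /choice[phi hphi] := shooting_exists B_gt0 h0 V0.
  by exists phi.
have phi_sol k' : ode_sol S 0 B (fun x => (V x + k' ^+ 2) / h ^+ 2) (phi k') (phi' k').
  by have [] := hphi k'.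
have phi_B k' : phi k' B = 1 by have [] := hphi k'.
have phi'_B k' : phi' k' B = 0 by have [] := hphi k'.
have neuP := neumann_eigenvalueP B_gt0 h0 V_cont phi_sol phi_B phi'_B.
have resP := resonanceP B_gt0 h0 V_cont V_supp phi_sol phi_B phi'_B.
pose a t := phi t 0; pose b t := h * phi' t 0.
pose Q k1 k2 := (k1 + k2) / h * shooting_mass B phi k1 k2.
have ca t : {for t, continuous a} := shooting_continuous B_gt0 h0 V0 phi_sol phi_B phi'_B (k := t).
have cb t : {for t, continuous b} := shooting_deriv_continuous B_gt0 h0 V0 phi_sol phi_B phi'_B (k := t).
have cQ t : {for t, continuous (Q t)}.
  apply: continuousM; last exact: (shooting_mass_continuous B_gt0 h0 V0 phi_sol phi_B phi'_B).
  apply: continuousM; last exact: cst_continuous.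
  by apply: continuousD; [exact: cst_continuous|exact: cvg_id].
have HQ t1 t2 : a t2 * b t1 - a t1 * b t2 = (t2 - t1) * Q t1 t2.
  exact: (shooting_wronskian B_gt0 h0 phi_sol phi_B phi'_B).
(* As k + 3 e <= t + 4 e, the cone lies within the tolerance of the tunnelling estimate at t; the
   factor 2 t / h of the mass is at least ck because t >= ck / 2 and h < 1. *)
have HM t : `|k - t| <= e -> `|b t| <= (k + 3 * e) * `|a t| -> M * a t ^+ 2 <= Q t t.
  rewrite ler_norml => /andP[t1 t2] bt.
  have [F F0 hF] := pw_primitive (ltW B_gt0)
    (pw_contM (pw_cont_within S (ltW B_gt0) (proj1 (proj1 (phi_sol t))))
      (pw_cont_within S (ltW B_gt0) (proj1 (proj1 (phi_sol t))))).
  have tk : ck / 2 <= t <= 2 * Ck.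
    by clear -t1 t2 ckk kCk e_ck ck_gt0 Ck0; apply/andP; split; lra.
  have hh : 0 < h < h1 by rewrite h0.
  have {}bt : `|h * phi' t 0| <= (t + c2 * expR (- (sigma / 4 / h))) * `|phi t 0|.
    by apply: (le_trans bt); apply: ler_wpM2r => //; lra.
  have := tunnel h t _ _ _ hh tk (phi_sol t) hF bt.
  rewrite /Q (shooting_massE B_gt0 phi_sol hF).
  have th : ck <= (t + t) / h by rewrite ler_pdivlMr//; have /andP[] := tk; nra.
  have E0 := expR_gt0 (sigma / h); have a0 := sqr_ge0 (a t).
  have : 0 <= c1 * expR (sigma / h) * a t ^+ 2 by apply: mulr_ge0 a0; rewrite ltW// mulr_gt0.
  rewrite /M -/(a t) => m0 m1.
  apply: (@le_trans _ _ (ck * (F B - F 0))); last by apply: ler_wpM2r => //; lra.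
  have -> : ck * c1 * expR (sigma / h) * a t ^+ 2 = ck * (c1 * expR (sigma / h) * a t ^+ 2) by ring.
  by rewrite ler_pM2l.
have near m m' : b k = m * k * a k ->
    m' = m - 1 /\ -1 <= m' <= 0 \/ m' = m + 1 /\ 0 <= m' <= 1 ->
    exists2 t, `|k - t| <= e /\ 0 < t & b t = m' * t * a t.
  move=> bk mm; have ek : e <= k by lra.
  have [t kt bt] := crossing_nearby e0 ek ca cb cQ HQ HM kM bk mm.
  exists t => //; split=> //; move: kt; rewrite ler_norml => /andP[]; lra.
have boundP t : bound_state V B h t <-> 0 < t /\ b t = 1 * t * a t.
  rewrite mul1r; split=> -[t0 H]; split=> //; first exact/(resP t t).
  exact/(resP t t).
have antiP t : antibound_state V B h t <-> 0 < t /\ b t = -1 * t * a t.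
  rewrite mulN1r /antibound_state -mulrN -rmorphN.
  by split=> -[t0 H]; split=> //; apply/(resP t (- t)) => //; rewrite sqrrN.
have neuP' t : neumann_eigenvalue V B h t <-> 0 < t /\ b t = 0 * t * a t.
  rewrite !mul0r; split=> [/neuP[t0 H]|[t0 /eqP]].
    by split=> //; rewrite /b H mulr0.
  by rewrite /b mulf_eq0 (negbTE h_neq0) => /eqP H; apply/neuP.
(* The slopes m k with m = 1, 0, -1 stand for the three notions. As the slope decreases with k,
   bound states are sought below a Neumann eigenvalue and antibound states above it, and
   conversely. *)
split=> [/neuP'[_ bk]|[/boundP[_ bk]|/antiP[_ bk]]].
- split.
    have [t [kt t0] bt] := near 0 1 bk ltac:(right; rewrite add0r lexx ler01; done).
    by exists t => //; apply/boundP.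
  have [t [kt t0] bt] := near 0 (-1) bk ltac:(left; rewrite sub0r lexx lerN10; done).
  by exists t => //; apply/antiP.
- have [t [kt t0] bt] := near 1 0 bk ltac:(left; rewrite subrr lexx lerN10; done).
  by exists t => //; apply/neuP'.
- have [t [kt t0] bt] := near (-1) 0 bk ltac:(right; rewrite addNr lexx ler01; done).
  by exists t => //; apply/neuP'.
Qed.
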